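(* There exists a constant $c\in(0,\infty)$ such that for every integer $k\geq 2$ we have, for integers $n\geq 2$, \[ k+1 - \big(1+o_k^{n\to\infty}(1)\big)\,\frac{(k+1)\log_2(k+1)-2k}{2\log_2 n} \leq t_{k,n} \leq k+1-\frac{c}{\log_2 n}. \] Here $o_k^{n\to\infty}(1)$ denotes a quantity depending on $k$ and $n$ that tends to $0$ as $n\to\infty$ for every fixed $k$; the constant $c$ does not depend on $k$ or $n$.
   Context: For a finite set $A\subset\mathbb{Z}^d$ and an integer $k\geq 2$, \[ P_k(A) := \big|\big\{(a,h_1,\ldots,h_k)\in(\mathbb{Z}^d)^{k+1} : a+\epsilon_1h_1+\cdots+\epsilon_kh_k\in A \text{ for every } (\epsilon_1,\ldots,\epsilon_k)\in\{0,1\}^k\big\}\big|. \] For integers $k,n\geq 2$, $t_{k,n}$ denotes the smallest number $t>0$ such that $P_k(A)\leq|A|^t$ holds for every positive integer $d$ and every subset $A$ of $\{0,1,2,\ldots,n-1\}^d$ (such a smallest number exists). *)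

(* Defs.v *)
From mathcomp Require Import all_boot all_order all_algebra finmap.
From mathcomp Require Import all_classical all_reals all_analysis.
Set Implicit Arguments.
Unset Strict Implicit.
Unset Printing Implicit Defensive.
Import Order.TTheory GRing.Theory Num.Theory.
Import numFieldNormedType.Exports.

Local Open Scope classical_set_scope.
Local Open Scope ring_scope.

(* The tuple (a, h_1, ..., h_k) is the pair u = (a, h); the vertex e in
   {0,1}^k is a boolean function, coerced to nat. *)
Definition cubes (k d : nat) (A : {fset 'rV[int]_d}) :
    set ('rV[int]_d * {ffun 'I_k -> 'rV[int]_d}) :=
  [set u : 'rV[int]_d * {ffun 'I_k -> 'rV[int]_d} |
     forall e : {ffun 'I_k -> bool},
       u.1 + \sum_(i < k) u.2 i *+ e i \in A].
Arguments cubes k {d} A _.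

(* fset_set returns fset0 on infinite sets; that case never occurs here, see
   finite_cubes below. *)
Definition P_ (k d : nat) (A : {fset 'rV[int]_d}) : nat :=
  #|` fset_set (cubes k A)|%fset.

Definition in_box (n d : nat) (A : {fset 'rV[int]_d}) : Prop :=
  forall x : 'rV[int]_d, x \in A -> forall i : 'I_d, 0 <= x 0 i < n%:Z.

Definition admissible_exponent (R : realType) (k n : nat) (t : R) : Prop :=
  0 < t /\
  forall d : nat, (0 < d)%N -> forall A : {fset 'rV[int]_d}, in_box n A ->
    (P_ k A)%:R <= (#|` A|%fset)%:R `^ t.

Definition smallest_exponent (R : realType) (k n : nat) (t : R) : Prop :=
  admissible_exponent k n t /\
  forall s : R, admissible_exponent k n s -> t <= s.

(* The default value 0 is irrelevant for n >= 2, see tkn_smallest below. *)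
Definition tkn (R : realType) (k n : nat) : R :=
  xget 0 [set t : R | smallest_exponent k n t].

Definition log2 (R : realType) (x : R) : R := ln x / ln 2.

Section CubesFinite.
Variables (d k : nat) (A : {fset 'rV[int]_d}).

Let g (u : A * {ffun 'I_k -> A}) : 'rV[int]_d * {ffun 'I_k -> 'rV[int]_d} :=
  (val u.1, [ffun i => val (u.2 i) - val u.1]).

Let cubes_sub : cubes k A `<=` range g.
Proof.
move=> [a h] /= H.
have aA : a \in A.
  have := H [ffun=> false]; rewrite big1 ?addr0 // => i _.
  by rewrite ffunE mulr0n.
have hA i : a + h i \in A.
  have := H [ffun j => j == i]; rewrite (bigD1 i) //= ffunE eqxx mulr1n.
  rewrite big1 ?addr0 // => j /negbTE ji.
  by rewrite ffunE ji mulr0n.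
exists ([` aA]%fset, [ffun i => [` hA i]%fset]) => //.
by congr pair; apply/ffunP => i; rewrite !ffunE /= addrC addKr.
Qed.

Lemma finite_cubes : finite_set (cubes k A).
Proof.
apply: sub_finite_set cubes_sub _.
exact/finite_image/finite_finset.
Qed.

Lemma P_le : (P_ k A <= #|` A|%fset ^ k.+1)%N.
Proof.
have -> : (#|` A|%fset ^ k.+1 = #|{: A * {ffun 'I_k -> A}}|)%N.
  by rewrite card_prod card_ffun card_ord -cardfE expnS.
have sub : (fset_set (cubes k A) `<=`
    [fset g u | u in {: A * {ffun 'I_k -> A}}])%fset.
  apply/fsubsetP => u; rewrite in_fset_set; last exact: finite_cubes.
  rewrite inE => /cubes_sub [v _ <-].
  by apply/imfsetP; exists v.
apply: leq_trans (fsubset_leq_card sub) _.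
apply: leq_trans (leq_imfset_card _ _ _) _.
by rewrite cardE.
Qed.

End CubesFinite.

Section Smallest.
Variables (R : realType) (k n : nat).

Let S : set R := [set t | admissible_exponent k n t].

Lemma admissible_succ : admissible_exponent k n (k.+1%:R : R).
Proof.
split; first by rewrite ltr0n.
move=> d d0 A _; rewrite powR_mulrn ?ler0n// -natrX ler_nat.
exact: P_le.
Qed.

Hypothesis n2 : (2 <= n)%N.

Let admissible_ge1 t : S t -> 1 <= t.
Proof.
move=> [t0 /(_ 1%N isT)].
pose A : {fset 'rV[int]_1} := [fset (0 : 'rV[int]_1); const_mx 1]%fset.
have neq : (0 : 'rV[int]_1) != const_mx 1.
  by apply/eqP => /rowP/(_ 0); rewrite !mxE.
have cA : #|` A|%fset = 2%N by rewrite cardfs2 neq.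
move=> /(_ A) H.
have boxA : in_box n A.
  move=> x; rewrite !inE => /orP[] /eqP -> i; rewrite !mxE.
    by rewrite lexx /= ltz_nat (leq_trans _ n2).
  by rewrite ler01 /= ltz_nat.
have {H} := H boxA; rewrite cA.
have PA : (2 <= P_ k A)%N.
  rewrite -cA /P_.
  pose f (x : 'rV[int]_1) := (x, [ffun=> 0] : {ffun 'I_k -> 'rV[int]_1}).
  have fi : injective f by move=> x y [].
  have -> : #|` A|%fset = #|` [fset f x | x in A]|%fset by rewrite (card_imfset _ _ fi).
  apply: fsubset_leq_card.
  apply/fsubsetP => u /imfsetP [x /= xA ->].
  rewrite in_fset_set; last exact: finite_cubes.
  rewrite inE /cubes /= => e; rewrite big1 ?addr0 // => i _.
  by rewrite ffunE mul0rn.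
move=> H; have {H PA} : (2 : R) <= 2 `^ t.
  by apply: le_trans H; rewrite ler_nat.
rewrite -ler_ln ?posrE ?powR_gt0 // ln_powR.
by rewrite -{1}[ln 2]mul1r ler_pM2r // ln_gt0 // ltr1n.
Qed.

Let inf_smallest : smallest_exponent k n (inf S).
Proof.
have lbS : has_lbound S by exists 1 => t /admissible_ge1.
have S0 : S !=set0 by exists k.+1%:R; exact: admissible_succ.
have inf1 : 1 <= inf S by apply: lb_le_inf => // t /admissible_ge1.
have inf0 : 0 < inf S by apply: lt_le_trans inf1.
split; last by move=> s Ss; apply: ge_inf.
split=> // d d0 A boxA.
have HS t : S t -> (P_ k A)%:R <= (#|` A|%fset)%:R `^ t :> R.
  by move=> [_ H]; exact: H.
have [P0|P0] := posnP (P_ k A); first by rewrite P0 powR_ge0.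
have [A0|A0] := posnP #|` A|%fset.
  have [t St] := S0; have := HS _ St; rewrite A0 !powR0 ?gt_eqF //.
  by case: St.
have Ap : (0 : R) < (#|` A|%fset)%:R by rewrite ltr0n.
have HL t : (((P_ k A)%:R : R) <= (#|` A|%fset)%:R `^ t) =
    (ln (P_ k A)%:R <= t * ln (#|` A|%fset)%:R).
  by rewrite -ler_ln ?posrE ?ltr0n ?powR_gt0 // ln_powR.
have [A1|A1] := leqP #|` A|%fset 1%N.
  have [t St] := S0; have := HS _ St.
  have -> : #|` A|%fset = 1%N by apply/eqP; rewrite eqn_leq A1.
  by rewrite !powR1.
have lA : (0 : R) < ln (#|` A|%fset)%:R by rewrite ln_gt0 // ltr1n.
rewrite HL -ler_pdivrMr //; apply: lb_le_inf => // t St.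
by rewrite ler_pdivrMr // -HL; exact: HS.
Qed.

Lemma tkn_smallest : smallest_exponent k n (tkn R k n).
Proof. by apply: xgetPex; exists (inf S); exact: inf_smallest. Qed.

End Smallest.

(* Main.v *)
Require Import Defs.
From mathcomp Require Import all_boot all_order all_algebra finmap.
From mathcomp Require Import all_classical all_reals all_analysis.
From mathcomp Require Import perm ring lra zify.
Import Order.TTheory GRing.Theory Num.Theory.
Import numFieldNormedType.Exports.
Set Implicit Arguments.
Unset Strict Implicit.
Unset Printing Implicit Defensive.
Local Open Scope classical_set_scope.
Local Open Scope ring_scope.

(** Write E(A) for the number of quadruples in A with a + b = c + d.

    Upper bound. A cube is determined by the parallelogram spanned by its first
    two directions and by one further vertex for each other direction, so
    P_k(A) <= |A|^(k-2) E(A) ([P_le_quads]), and it is enough to show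
    E(A) <= |A|^t with t = 3 - c / log2 n.  This follows from a functional
    inequality which tensorizes: for weights g >= 0 on {0, ..., n-1},
      sum over a + b = c + d of (g a g b g c g d)^(t/4) <= (sum g)^t.
    A fibrewise application of it and an induction on the dimension
    ([energy_bound_prod]) give the same inequality on {0, ..., n-1}^d, to be
    used with the indicator of A.  In dimension one, Young's inequality is the
    case t = 3, and replacing 3 by t costs at most the constant factor 2^c
    because n^(3-t) = 2^c.  So a constant gain in Young's inequality is needed.
    If some threshold splits the mass of a weight w into two parts that are both not
    small, such a gain exists because Z is ordered ([energy_spread]): were it
    an equality case, then for a, b, c independent of law w the point
    d = a + b - c would make (a, b, d) independent of law w too, but a and b
    above the threshold push d above it too often.  If no threshold splits the
    mass, almost all of it sits on one atom; then the quadruples off the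
    diagonal contribute a power higher than 1 of the remaining mass
    ([energy_atom]), which wins without any constant.

    Lower bound. Take for A the integer points of a Euclidean ball of radius
    rho in a fixed large dimension d.  In high dimension k + 1 independent
    points v_0, ..., v_k of a ball of radius r are nearly orthogonal with
    probability at least 1/2 ([card_near_orthogonal], by second moments), and
    then all sums v_0 + v_1 eps_1 + ... + v_k eps_k with signs eps have norm
    about r sqrt(k+1).  These sums, divided by two and rounded, are the
    vertices of a cube with directions v_1, ..., v_k, so that with
    r = 2 rho / sqrt(k+1) one gets about N(r)^(k+1) / 2^(d+1) cubes inside A
    ([many_cubes]), N(r) being the number of integer points of the ball.  As
    N(r) is asymptotic to a constant times r^d ([zvol_cvg]), comparing with
    N(rho)^(k+1) gives, as n goes to infinity with d fixed,
      (k + 1 - t) ln n <= (k+1)/2 ln (k+1) - k ln 2 + O_k(1/d) + o(1). *)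

(** * Sums over fibres, and energies *)

(** The matrix with entries 1 when s x = s y and 0 otherwise is positive
    semidefinite: the sum is the sum over v of the squares of the sums of u over
    the fibres of s.  All Cauchy-Schwarz arguments on additive quadruples below
    are instances of this. *)
Lemma fiber_sum_ge0 (R : realType) (X : finType) (s : X -> nat) (u : X -> R) :
  0 <= \sum_(q : X * X | s q.1 == s q.2) u q.1 * u q.2.
Proof.
pose M := (\max_x s x).+1.
have sM x : (s x < M)%N by rewrite ltnS leq_bigmax.
rewrite (partition_big (fun q : X * X => Ordinal (sM q.1)) xpredT) //=.
apply: sumr_ge0 => v _.
have -> : \sum_(q : X * X | (s q.1 == s q.2) && (Ordinal (sM q.1) == v))
    u q.1 * u q.2 = (\sum_(x | s x == v) u x) ^+ 2.
  rewrite expr2 big_distrlr /= pair_big /=; apply: eq_bigl => q.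
  rewrite -val_eqE /= andbC; case: eqP => //= ->; exact: eq_sym.
exact: sqr_ge0.
Qed.

Lemma fiber_sum_amgm (R : realType) (X : finType) (s : X -> nat)
    (F G : X -> R) :
  2 * (\sum_(q : X * X | s q.1 == s q.2) F q.1 * G q.2) <=
  \sum_(q : X * X | s q.1 == s q.2) F q.1 * F q.2 +
  \sum_(q : X * X | s q.1 == s q.2) G q.1 * G q.2.
Proof.
have := fiber_sum_ge0 s (fun x => F x - G x).
have -> : \sum_(q : X * X | s q.1 == s q.2) (F q.1 - G q.1) * (F q.2 - G q.2) =
    \sum_(q : X * X | s q.1 == s q.2) F q.1 * F q.2 +
    \sum_(q : X * X | s q.1 == s q.2) G q.1 * G q.2 -
    (\sum_(q : X * X | s q.1 == s q.2) F q.1 * G q.2 +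
     \sum_(q : X * X | s q.1 == s q.2) G q.1 * F q.2).
  by rewrite -!big_split -sumrB /=; apply: eq_bigr => q _; ring.
have -> : \sum_(q : X * X | s q.1 == s q.2) G q.1 * F q.2 =
    \sum_(q : X * X | s q.1 == s q.2) F q.1 * G q.2.
  have swapK : involutive (fun q : X * X => (q.2, q.1)) by case.
  rewrite (reindex_inj (inv_inj swapK)) /=.
  by apply: eq_big => [q|q _]; [exact: eq_sym | exact: mulrC].
by lra.
Qed.

Lemma sum_le_inj (R : realType) (X Y : finType) (phi : X -> Y)
    (P : pred X) (S : pred Y) (F : Y -> R) :
  (forall y, 0 <= F y) -> {in P &, injective phi} ->
  (forall x, P x -> S (phi x)) ->
  \sum_(x | P x) F (phi x) <= \sum_(y | S y) F y.
Proof.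
move=> F0 inj PS.
rewrite (_ : \sum_(x | P x) _ = \sum_(x in P) F (phi x)) //.
rewrite -(big_imset _ inj) /= [leRHS](bigID (mem [set phi x | x in P]%SET)) /=.
rewrite -[leLHS]addr0 lerD ?sumr_ge0 //.
rewrite le_eqVlt; apply/orP; left; apply/eqP.
apply: eq_bigl => y; rewrite andb_idl // => /imsetP[x xP ->]; exact: PS.
Qed.

Lemma cauchy_schwarz_sum (R : realType) (X : finType) (P : pred X)
    (u v : X -> R) :
  (\sum_(x | P x) u x * v x) ^+ 2 <=
  (\sum_(x | P x) u x ^+ 2) * (\sum_(x | P x) v x ^+ 2).
Proof.
have H : 0 <= \sum_(x | P x) \sum_(y | P y) (u x * v y - u y * v x) ^+ 2.
  by apply: sumr_ge0 => x _; apply: sumr_ge0 => y _; exact: sqr_ge0.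
suff E : \sum_(x | P x) \sum_(y | P y) (u x * v y - u y * v x) ^+ 2 =
   2 * ((\sum_(x | P x) u x ^+ 2) * (\sum_(x | P x) v x ^+ 2)) -
   2 * (\sum_(x | P x) u x * v x) ^+ 2.
  by move: H; rewrite E; lra.
rewrite expr2 !big_distrlr /=.
rewrite (_ : \sum_(i | P i) \sum_(j | P j) u i ^+ 2 * v j ^+ 2 = 
   2^-1 * (\sum_(i | P i) \sum_(j | P j) u i ^+ 2 * v j ^+ 2 +
    \sum_(i | P i) \sum_(j | P j) u j ^+ 2 * v i ^+ 2)); last first.
  rewrite [X in _ + X]exchange_big /=; lra.
rewrite mulrA divff ?pnatr_eq0 // mul1r -big_split /= big_distrr /= -sumrB.
apply: eq_bigr => x _; rewrite -big_split /= big_distrr /= -sumrB.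
by apply: eq_bigr => y _; ring.
Qed.

(** The relation [par] stands for x.1 + x.2 = y.1 + y.2.  It is kept abstract so
    that products of index sets can be treated by induction on the dimension. *)
Definition energy (R : realType) (T : finType) (par : rel (T * T))
    (f1 f2 f3 f4 : T -> R) : R :=
  \sum_(q : (T * T) * (T * T) | par q.1 q.2)
    f1 q.1.1 * f2 q.1.2 * (f3 q.2.1 * f4 q.2.2).

Definition self_energy (R : realType) (T : finType) (par : rel (T * T))
    (f : T -> R) : R := energy par f f f f.

Definition same_sum (n : nat) : rel ('I_n * 'I_n) :=
  fun x y => (x.1 + x.2 == y.1 + y.2)%N.

Arguments same_sum n : clear implicits.

(** The Gowers-Cauchy-Schwarz inequality in its additive form: group the
    quadruples first by the common sum a + b = c + d, then by the common
    difference a - c = d - b, using the arithmetic-geometric mean inequality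
    each time.  The product form is recovered in [energy_powR_le] by
    normalization. *)
Lemma energy_le_mean (R : realType) (n : nat) (f1 f2 f3 f4 : 'I_n -> R) :
  energy (same_sum n) f1 f2 f3 f4 <=
  (self_energy (same_sum n) f1 + self_energy (same_sum n) f2 +
   self_energy (same_sum n) f3 + self_energy (same_sum n) f4) / 4.
Proof.
pose E := self_energy (R := R) (same_sum n); rewrite -!/(E _).
pose X := ('I_n * 'I_n)%type.
pose s (x : X) := (x.1 + x.2)%N.
(* the difference, shifted by n to stay in nat *)
pose s' (x : X) := (x.1 + (n - x.2))%N.
have H1 : 2 * energy (same_sum n) f1 f2 f3 f4 <=
    energy (same_sum n) f1 f2 f1 f2 + energy (same_sum n) f3 f4 f3 f4.
  exact: (fiber_sum_amgm s (fun x => f1 x.1 * f2 x.2) (fun x => f3 x.1 * f4 x.2)).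
have sq f : \sum_(q : X * X | s' q.1 == s' q.2)
    (f q.1.1 * f q.1.2) * (f q.2.1 * f q.2.2) = E f.
  rewrite /E /self_energy /energy.
  pose h (q : X * X) : X * X := ((q.1.1, q.2.2), (q.2.1, q.1.2)).
  have hK : involutive h by move=> [[a b] [c d]].
  rewrite (reindex_inj (inv_inj hK)) /=; apply: eq_big => [q|q _]; last by ring.
  rewrite /s' /same_sum /=.
  case: q => [[a b] [c d]] /=; have := ltn_ord d; have := ltn_ord b => bn dn.
  by apply/eqP/eqP; lia.
have H2 f g : 2 * energy (same_sum n) f g f g <= E f + E g.
  have := fiber_sum_amgm s' (fun x => f x.1 * f x.2) (fun x => g x.1 * g x.2).
  rewrite !sq; apply: le_trans; rewrite ler_pM2l // le_eqVlt; apply/orP; left.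
  apply/eqP; rewrite /energy.
  pose h (q : X * X) : X * X := ((q.1.1, q.2.1), (q.2.2, q.1.2)).
  have hb : injective h by move=> [[a b] [c d]] [[? ?] [? ?]] [-> -> -> ->].
  rewrite [RHS](reindex_inj hb) /=; apply: eq_big => [q|q _] /=; last by ring.
  rewrite /s' /same_sum /=.
  case: q => [[a b] [c d]] /=; have := ltn_ord c; have := ltn_ord d => bn dn.
  have := ltn_ord b => bb.
  by apply/eqP/eqP; lia.
have := H2 f1 f2; have := H2 f3 f4; lra.
Qed.

(** * A gain in Young's inequality for weights split by a threshold *)

(** The Hellinger affinity of two Bernoulli laws bounds their distance in total
    variation. *)
Lemma bernoulli_affinity (R : realType) (u v : R) :
  0 <= u <= 1 -> 0 <= v <= 1 ->
  Num.sqrt (u * v) + Num.sqrt ((1 - u) * (1 - v)) <= 1 - (u - v) ^+ 2 / 4.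
Proof.
move=> /andP[u0 u1] /andP[v0 v1].
rewrite !sqrtrM ?subr_ge0 //.
have {1}-> : u - v = Num.sqrt u ^+ 2 - Num.sqrt v ^+ 2 by rewrite !sqr_sqrtr.
have : Num.sqrt u ^+ 2 + Num.sqrt (1 - u) ^+ 2 = 1.
  by rewrite !sqr_sqrtr ?subr_ge0 //; lra.
have : Num.sqrt v ^+ 2 + Num.sqrt (1 - v) ^+ 2 = 1.
  by rewrite !sqr_sqrtr ?subr_ge0 //; lra.
have := sqrtr_ge0 u; have := sqrtr_ge0 v.
have := sqrtr_ge0 (1 - u); have := sqrtr_ge0 (1 - v).
move: (Num.sqrt u) (Num.sqrt v) (Num.sqrt (1 - u)) (Num.sqrt (1 - v)).
move=> a b c e e0 c0 b0 a0 be ac.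
have bnd (x y : R) : 0 <= x -> 0 <= y -> x <= 1 -> y <= 1 ->
    (x ^+ 2 - y ^+ 2) ^+ 2 <= 4 * (x - y) ^+ 2.
  move=> x0 y0 x1 y1.
  rewrite subr_sqr exprMn mulrC ler_wpM2r ?sqr_ge0 //.
  have -> : (4 : R) = 2 ^+ 2 by ring.
  by rewrite ler_sqr ?nnegrE; lra.
have a1 : a <= 1 by nra.
have b1 : b <= 1 by nra.
have c1 : c <= 1 by nra.
have e1 : e <= 1 by nra.
have h1 := bnd _ _ a0 b0 a1 b1.
have h2 := bnd _ _ c0 e0 c1 e1.
have h3 : (c ^+ 2 - e ^+ 2) ^+ 2 = (a ^+ 2 - b ^+ 2) ^+ 2.
  have -> : c ^+ 2 = 1 - a ^+ 2 by lra.
  have -> : e ^+ 2 = 1 - b ^+ 2 by lra.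
  ring.
move: h2; rewrite h3 => h2.
move: h1 h2; set D := (_ - _) ^+ 2; rewrite !sqrrB.
lra.
Qed.

Lemma sum_triple (R : realType) (X : finType) (P1 P2 P3 : pred X)
    (f1 f2 f3 : X -> R) :
  \sum_(y : X * X * X | [&& P1 y.1.1, P2 y.1.2 & P3 y.2])
    f1 y.1.1 * f2 y.1.2 * f3 y.2 =
  (\sum_(x | P1 x) f1 x) * (\sum_(x | P2 x) f2 x) * (\sum_(x | P3 x) f3 x).
Proof.
rewrite big_distrlr /= pair_big /= big_distrlr /= pair_big /=.
by apply: eq_bigl => y; rewrite andbA.
Qed.

(** With w = z^4, this is a quantitative strict Young inequality.  Let T_d be the
    law of (a, b, c, d) when a, b, c are independent of law w and
    d = a + b - c, and T_c the one when a, b, d are independent.  The energy of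
    z^3 is at most the affinity of T_c and T_d.  If q is the mass of H, the
    event that a, b, d all lie in H has probability q^3 under T_c, and at least
    q^2 (1 - q) + q^3 / 2 under T_d: given a, b in H, the hypotheses on [r]
    force d into H as soon as [r c a], which holds if c is not in H, and with
    probability at least 1/2 if c is in H, by symmetry.  For q <= 1/2 the gap is
    at least q^2 / 4.  Taking for H an upper set with the order [<=], or a lower
    set with [>=], covers both sides of a threshold. *)
Lemma energy_spread (R : realType) (n : nat) (H : pred 'I_n) (r : rel 'I_n)
    (z : 'I_n -> R) :
  total r ->
  (forall a c, H a -> ~~ H c -> r c a) ->
  (forall a b c d : 'I_n, (a + b = c + d)%N -> H b -> r c a -> H d) ->
  (forall i, 0 <= z i) -> \sum_i z i ^+ 4 = 1 ->
  \sum_(i | H i) z i ^+ 4 <= 1 / 2 ->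
  self_energy (same_sum n) (fun i => z i ^+ 3) <=
    1 - (\sum_(i | H i) z i ^+ 4) ^+ 4 / 64.
Proof.
move=> rtot rH rstep z0 zsum.
set q := \sum_(i | H i) _ => qle.
pose w i := z i ^+ 4.
have w0 i : 0 <= w i by rewrite exprn_ge0.
have q0 : 0 <= q by apply: sumr_ge0 => i _; exact: w0.
pose X := ('I_n * 'I_n)%type.
pose P (x : X * X) := same_sum n x.1 x.2.
pose S (x : X * X) := [&& H x.1.1, H x.1.2 & H x.2.2].
pose u (x : X * X) := z x.1.1 ^+ 2 * z x.1.2 ^+ 2 * z x.2.1 ^+ 2.
pose v (x : X * X) := z x.1.1 ^+ 2 * z x.1.2 ^+ 2 * z x.2.2 ^+ 2.
pose F (y : 'I_n * 'I_n * 'I_n) := w y.1.1 * w y.1.2 * w y.2.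
have F0 y : 0 <= F y by rewrite !mulr_ge0.
pose pc (x : X * X) := (x.1.1, x.1.2, x.2.1).
pose pd (x : X * X) := (x.1.1, x.1.2, x.2.2).
have uE x : u x ^+ 2 = F (pc x) by rewrite /u /F /w /=; ring.
have vE x : v x ^+ 2 = F (pd x) by rewrite /v /F /w /=; ring.
have pc_inj (Q : pred (X * X)) : (forall x, Q x -> P x) -> {in Q &, injective pc}.
  move=> QP [[a b] [c d]] [[a' b'] [c' d']] /QP h /QP h' /= [ea eb ec].
  move: h h'; rewrite /P /same_sum /= ea eb ec => /eqP h /eqP h'.
  by congr (_, (_, _)); apply: val_inj => /=; lia.
have pd_inj (Q : pred (X * X)) : (forall x, Q x -> P x) -> {in Q &, injective pd}.
  move=> QP [[a b] [c d]] [[a' b'] [c' d']] /QP h /QP h' /= [ea eb ec].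
  move: h h'; rewrite /P /same_sum /= ea eb ec => /eqP h /eqP h'.
  by congr (_, (_, _)); apply: val_inj => /=; lia.
have Fsum : \sum_y F y = 1.
  have := sum_triple (fun=> true) (fun=> true) (fun=> true) w w w.
  by rewrite /= zsum !mulr1 => <-.
(* The cubes are the geometric mean of two terms that the exchange of the two
   sides of a + b = c + d permutes, so their sums agree. *)
have EA : self_energy (same_sum n) (fun i => z i ^+ 3) <= \sum_(x | P x) u x * v x.
  have sw : \sum_(x | P x) u x * v x =
      \sum_(x | P x) z x.2.1 ^+ 4 * z x.2.2 ^+ 4 * (z x.1.1 ^+ 2 * z x.1.2 ^+ 2).
    have swapK : involutive (fun q : X * X => (q.2, q.1)) by case.
    rewrite (reindex_inj (inv_inj swapK)) /=.
    apply: eq_big => [x|x _]; first by rewrite /P /same_sum /= eq_sym.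
    by rewrite /u /v /=; ring.
  suff : 2 * self_energy (same_sum n) (fun i => z i ^+ 3) <=
    \sum_(x | P x) u x * v x + \sum_(x | P x) u x * v x by lra.
  rewrite {1}sw /self_energy /energy big_distrr -big_split /=.
  apply: ler_sum => x _; rewrite /u /v.
  move: (z x.1.1) (z x.1.2) (z x.2.1) (z x.2.2) => a b c d.
  have := sqr_ge0 (a ^+ 2 * b ^+ 2 * c * d - a * b * c ^+ 2 * d ^+ 2).
  by rewrite sqrrB; lra.
rewrite (bigID S) /= in EA.
set u1 := \sum_(x | P x && S x) u x ^+ 2.
set v1 := \sum_(x | P x && S x) v x ^+ 2.
pose u2 := \sum_(x | P x && ~~ S x) u x ^+ 2.
pose v2 := \sum_(x | P x && ~~ S x) v x ^+ 2.
have u1_0 : 0 <= u1 by apply: sumr_ge0 => *; exact: sqr_ge0.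
have v1_0 : 0 <= v1 by apply: sumr_ge0 => *; exact: sqr_ge0.
have u2_0 : 0 <= u2 by apply: sumr_ge0 => *; exact: sqr_ge0.
have v2_0 : 0 <= v2 by apply: sumr_ge0 => *; exact: sqr_ge0.
(* The masses need not add up to 1: a triple (a, b, c) whose fourth point lies
   outside of the interval gives no quadruple. *)
have u12 : u1 + u2 <= 1.
  rewrite -Fsum /u1 /u2 -bigID /=; under eq_bigr do rewrite uE.
  exact: (sum_le_inj F0 (pc_inj P (fun _ h => h))).
have v12 : v1 + v2 <= 1.
  rewrite -Fsum /v1 /v2 -bigID /=; under eq_bigr do rewrite vE.
  exact: (sum_le_inj F0 (pd_inj P (fun _ h => h))).
have v1q : v1 <= q ^+ 3.
  have -> : q ^+ 3 = \sum_(y : 'I_n * 'I_n * 'I_n |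
      [&& H y.1.1, H y.1.2 & H y.2]) F y.
    by rewrite (sum_triple H H H w w w) -/q; ring.
  rewrite /v1; under eq_bigr do rewrite vE.
  apply: (sum_le_inj F0) => [|x /andP[]//].
  by apply: pd_inj => x /andP[].
have u2q : u2 <= 1 - (q ^+ 2 * (1 - q) + q ^+ 3 / 2).
  pose G (y : 'I_n * 'I_n * 'I_n) := [&& H y.1.1, H y.1.2 & r y.2 y.1.1].
  have : u2 <= \sum_(y | ~~ G y) F y.
    rewrite /u2; under eq_bigr do rewrite uE.
    apply: (sum_le_inj F0); first by apply: pc_inj => x /andP[].
    move=> [[a b] [c d]] /andP[/eqP /= Pab]; apply: contra.
    rewrite /G /S /= => /and3P[-> Hb rca] /=; rewrite Hb /=.
    exact: rstep Pab Hb rca.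
  suff : q ^+ 2 * (1 - q) + q ^+ 3 / 2 <= \sum_(y | G y) F y.
    by move: Fsum; rewrite (bigID G) /=; lra.
  have -> : \sum_(y | G y) F y =
      \sum_(y : X | H y.1 && r y.2 y.1) w y.1 * w y.2 * q.
    rewrite -big_distrl big_distrlr pair_big /=.
    pose h (y : X * 'I_n) := (y.1.1, y.2, y.1.2).
    have hb : injective h by move=> [[a b] c] [[? ?] ?] [-> -> ->].
    rewrite (reindex_inj hb) /=; apply: eq_big => [y|y _] /=.
      by rewrite /G /h /=; case: (H y.1.1) => //=; rewrite andbC.
    by rewrite /F /h /w /=; ring.
  rewrite -big_distrl /=.
  suff : q * (1 - q) + q ^+ 2 / 2 <=
      \sum_(y : X | H y.1 && r y.2 y.1) w y.1 * w y.2.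
    by move=> h; have := ler_wpM2r q0 h; apply: le_trans; lra.
  rewrite (bigID (fun y : X => H y.2)) /= addrC lerD //.
    have -> : 1 - q = \sum_(i | ~~ H i) w i.
      by move: zsum; rewrite (bigID H) /= -/q => <-; rewrite addrAC subrr add0r.
    rewrite big_distrlr pair_big /= le_eqVlt; apply/orP; left; apply/eqP.
    apply: eq_bigl => y; rewrite -andbA; case Hy : (H y.1) => //=.
    by case Hy2 : (H y.2) => /=; rewrite ?andbF // rH // Hy2.
  have -> : q ^+ 2 = \sum_(y : X | H y.1 && H y.2) w y.1 * w y.2.
    by rewrite expr2 big_distrlr pair_big.
  set T := leRHS.
  have : T = \sum_(y : X | H y.1 && r y.1 y.2 && H y.2) w y.1 * w y.2.
    have swapK : involutive (fun q : X => (q.2, q.1)) by case.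
    rewrite /T (reindex_inj (inv_inj swapK)) /=.
    by apply: eq_big => [y|y _]; [case: (H y.1); case: (H y.2); case: (r y.1 y.2) | rewrite mulrC].
  have : \sum_(y : X | H y.1 && H y.2) w y.1 * w y.2 <=
    T + \sum_(y : X | H y.1 && r y.1 y.2 && H y.2) w y.1 * w y.2.
    rewrite (bigID (fun y : X => r y.2 y.1)) /= lerD //.
      rewrite le_eqVlt; apply/orP; left; apply/eqP.
      by apply: eq_bigl => y; rewrite andbAC.
    rewrite [leRHS](bigID (fun y : X => ~~ r y.2 y.1)) /=.
    rewrite -[leLHS]addr0 lerD ?sumr_ge0 //; last first.
      by move=> *; rewrite mulr_ge0.
    rewrite le_eqVlt; apply/orP; left; apply/eqP.
    apply: eq_bigl => y; case: (H y.1) => //=; case: (H y.2) => //=.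
      by have := rtot y.1 y.2; case: (r y.2 y.1) => //=; rewrite ?orbF ?andbF // => ->.
    by rewrite !andbF.
  by lra.
have sqrt_le (x y b : R) : 0 <= b -> x ^+ 2 <= y -> y <= b -> x <= Num.sqrt b.
  move=> b0 xy yb; rewrite (le_trans (ler_norm x)) // -sqrtr_sqr ler_wsqrtr //.
  exact: le_trans yb.
(* u1 <= 1 - u2 and v2 <= 1 - v1: padding the two laws only increases the
   bound, and makes them Bernoulli laws. *)
have A1 : \sum_(x | P x && S x) u x * v x <= Num.sqrt ((1 - u2) * v1).
  have cs : _ <= u1 * v1 := cauchy_schwarz_sum (fun x => P x && S x) u v.
  apply: sqrt_le cs _; first by rewrite mulr_ge0 //; lra.
  by rewrite ler_wpM2r //; lra.
have A2 : \sum_(x | P x && ~~ S x) u x * v x <= Num.sqrt ((1 - (1 - u2)) * (1 - v1)).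
  have cs : _ <= u2 * v2 := cauchy_schwarz_sum (fun x => P x && ~~ S x) u v.
  apply: sqrt_le cs _; first by rewrite mulr_ge0 //; lra.
  have -> : 1 - (1 - u2) = u2 by ring.
  by rewrite ler_wpM2l //; lra.
have B : Num.sqrt ((1 - u2) * v1) + Num.sqrt ((1 - (1 - u2)) * (1 - v1)) <=
    1 - (1 - u2 - v1) ^+ 2 / 4.
  by apply: bernoulli_affinity; lra.
have gap : q ^+ 2 / 4 <= 1 - u2 - v1.
  suff : q ^+ 2 / 4 <= q ^+ 2 * (1 - q) + q ^+ 3 / 2 - q ^+ 3 by lra.
  suff : 0 <= q ^+ 2 * (3 / 4 - 3 / 2 * q) by lra.
  by rewrite mulr_ge0 ?sqr_ge0 //; lra.
have gap2 : (q ^+ 2 / 4) ^+ 2 <= (1 - u2 - v1) ^+ 2.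
  by rewrite lerXn2r // nnegrE; have := sqr_ge0 q; lra.
have -> : q ^+ 4 / 64 = (q ^+ 2 / 4) ^+ 2 / 4 by field.
lra.
Qed.

(** * Weights split by a threshold, and weights close to an atom *)

Lemma fiber_sum_parallelogram (R : realType) (X : finType) (s : X -> nat)
    (F G : X -> R) :
  \sum_(q : X * X | s q.1 == s q.2) (F q.1 + G q.1) * (F q.2 + G q.2) <=
  2 * (\sum_(q : X * X | s q.1 == s q.2) F q.1 * F q.2) +
  2 * (\sum_(q : X * X | s q.1 == s q.2) G q.1 * G q.2).
Proof.
have := fiber_sum_ge0 s (fun x => F x - G x).
suff -> : \sum_(q : X * X | s q.1 == s q.2) (F q.1 - G q.1) * (F q.2 - G q.2) =
  2 * (\sum_(q : X * X | s q.1 == s q.2) F q.1 * F q.2) +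
  2 * (\sum_(q : X * X | s q.1 == s q.2) G q.1 * G q.2) -
  \sum_(q : X * X | s q.1 == s q.2) (F q.1 + G q.1) * (F q.2 + G q.2) by lra.
by rewrite !big_distrr /= -big_split -sumrB /=; apply: eq_bigr => q _; ring.
Qed.

(** Write f as a unit atom at x0 plus g.  A quadruple with exactly three entries
    equal to x0 does not exist, so no term linear in g appears, and the terms
    that are quadratic in g are sums of squares up to a constant. *)
Lemma energy_near_atom (R : realType) (n : nat) (x0 : 'I_n) (f : 'I_n -> R) :
  (forall i, 0 <= f i) -> f x0 = 1 ->
  self_energy (same_sum n) f <=
    1 + 10 * (\sum_(i | i != x0) f i ^+ 2)
      + 2 * self_energy (same_sum n) (fun i => if i == x0 then 0 else f i).
Proof.
move=> f0 fx0; set g : 'I_n -> R := fun i => if i == x0 then 0 else f i.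
pose X := ('I_n * 'I_n)%type; pose s (x : X) := (x.1 + x.2)%N.
pose dl i : R := (i == x0)%:R.
have g0 i : 0 <= g i by rewrite /g; case: ifP.
have gx0 : g x0 = 0 by rewrite /g eqxx.
have fE i : f i = dl i + g i.
  by rewrite /dl /g; case: eqP => [->|_]; rewrite ?fx0 ?addr0 ?add0r.
pose D (x : X) := dl x.1 * dl x.2.
pose K1 (x : X) := dl x.1 * g x.2.
pose K2 (x : X) := g x.1 * dl x.2.
pose H (x : X) := g x.1 * g x.2.
pose M x := K1 x + K2 x + H x.
set B := \sum_(i | _) _.
have BE : B = \sum_i g i ^+ 2.
  rewrite /B big_mkcond /=; apply: eq_bigr => i _; rewrite /g.
  by case: eqP => //=; rewrite expr0n.
pose Q (F G : X -> R) := \sum_(q : X * X | s q.1 == s q.2) F q.1 * G q.2.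
have QH : Q H H = self_energy (same_sum n) g by [].
have EQ : self_energy (same_sum n) f = Q D D + 2 * Q D M + Q M M.
  have sw : Q M D = Q D M.
    have swapK : involutive (fun q : X * X => (q.2, q.1)) by case.
    rewrite /Q (reindex_inj (inv_inj swapK)) /=.
    by apply: eq_big => [x|x _]; [exact: eq_sym | exact: mulrC].
  have -> : 2 * Q D M = Q D M + Q M D by rewrite sw; ring.
  rewrite /self_energy /energy /Q -!big_split /=.
  apply: eq_bigr => q _; rewrite !fE /M /D /K1 /K2 /H; ring.
have QDE (G : X -> R) : Q D G = \sum_(y : X | s (x0, x0) == s y) G y.
  rewrite /Q -(pair_big_dep xpredT (fun x y => s x == s y)
    (fun x y => D x * G y)) /= (bigD1 (x0, x0)) //= [X in _ + X]big1 ?addr0.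
    by apply: eq_bigr => y _; rewrite /D /dl /= eqxx !mul1r.
  move=> [a b] ab; apply: big1 => y _; rewrite /D /dl /=.
  move: ab; rewrite xpair_eqE.
  by case: (a == x0); case: (b == x0) => //= _; rewrite ?mul0r ?mulr0 ?mul0r.
have QDD : Q D D = 1.
  rewrite QDE (bigD1 (x0, x0)) /= // big1 ?addr0; first by rewrite /D /dl !eqxx mul1r.
  move=> [a b] /andP[_]; rewrite xpair_eqE /D /dl /=.
  by case: (a == x0); case: (b == x0) => //= _; rewrite ?mul0r ?mulr0.
have QDM : Q D M <= B.
  rewrite QDE.
  have h1 : \sum_(y : X | s (x0, x0) == s y) g y.1 ^+ 2 <= B.
    rewrite BE.
    apply: (@sum_le_inj _ _ _ fst _ xpredT (fun i => g i ^+ 2)) => //.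
      by move=> *; exact: sqr_ge0.
    move=> [a b] [c d] /eqP; rewrite /s /= => h /eqP /= h' e.
    by rewrite e; congr pair; apply: val_inj => /=; subst; lia.
  have h2 : \sum_(y : X | s (x0, x0) == s y) g y.2 ^+ 2 <= B.
    rewrite BE.
    apply: (@sum_le_inj _ _ _ snd _ xpredT (fun i => g i ^+ 2)) => //.
      by move=> *; exact: sqr_ge0.
    move=> [a b] [c d] /eqP; rewrite /s /= => h /eqP /= h' e.
    by rewrite e; congr pair; apply: val_inj => /=; subst; lia.
  suff : \sum_(y : X | s (x0, x0) == s y) M y <=
    \sum_(y : X | s (x0, x0) == s y) (2^-1 * g y.1 ^+ 2 + 2^-1 * g y.2 ^+ 2).
    by rewrite [X in _ <= X -> _]big_split /= -!mulr_sumr; lra.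
  apply: ler_sum => -[a b]; rewrite /s /= => /eqP h.
  rewrite /M /K1 /K2 /H /dl /=.
  have [ea|na] := eqVneq a x0.
    have -> : b = x0 by apply: val_inj; move: h; rewrite /= ea; lia.
    by rewrite ea gx0 eqxx; lra.
  have -> /= : (b == x0) = false.
    apply/negbTE; apply: contra na => /eqP eb; apply/eqP; apply: val_inj => /=.
    by move: h; rewrite eb; lia.
  by have := sqr_ge0 (g a - g b); rewrite sqrrB; lra.
have QK1 : Q K1 K1 <= B.
  have -> : Q K1 K1 = \sum_(q : X * X | [&& s q.1 == s q.2, q.1.1 == x0 & q.2.1 == x0])
      g q.1.2 ^+ 2.
    rewrite /Q big_mkcond [RHS]big_mkcond /=; apply: eq_bigr => -[[a b] [c d]] _.
    rewrite /K1 /dl /s /=; case: eqP => //= h.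
    case: eqP => [ea|_] /=; last by rewrite !mul0r.
    case: eqP => [ec|_] /=; last by rewrite !mul0r mulr0.
    rewrite !mul1r expr2; congr (_ * g _); apply: val_inj => /=.
    by move: h; rewrite ea ec; lia.
  rewrite BE.
  apply: (@sum_le_inj _ _ _ (fun q : X * X => q.1.2) _ xpredT (fun i => g i ^+ 2)) => //.
    by move=> *; exact: sqr_ge0.
  move=> [[a b] [c d]] [[a' b'] [c' d']] /and3P[] /=; rewrite /s /=.
  move=> /eqP h /eqP ea /eqP ec /and3P[] /= /eqP h' /eqP ea' /eqP ec' e; subst.
  by congr (_, (_, _)); apply: val_inj => /=; lia.
have QK2 : Q K2 K2 <= B.
  have -> : Q K2 K2 = \sum_(q : X * X | [&& s q.1 == s q.2, q.1.2 == x0 & q.2.2 == x0])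
      g q.1.1 ^+ 2.
    rewrite /Q big_mkcond [RHS]big_mkcond /=; apply: eq_bigr => -[[a b] [c d]] _.
    rewrite /K2 /dl /s /=; case: eqP => //= h.
    case: eqP => [ea|_] /=; last by rewrite !mulr0 mul0r.
    case: eqP => [ec|_] /=; last by rewrite !mulr0.
    rewrite !mulr1 expr2; congr (_ * g _); apply: val_inj => /=.
    by move: h; rewrite ea ec; lia.
  rewrite BE.
  apply: (@sum_le_inj _ _ _ (fun q : X * X => q.1.1) _ xpredT (fun i => g i ^+ 2)) => //.
    by move=> *; exact: sqr_ge0.
  move=> [[a b] [c d]] [[a' b'] [c' d']] /and3P[] /=; rewrite /s /=.
  move=> /eqP h /eqP ea /eqP ec /and3P[] /= /eqP h' /eqP ea' /eqP ec' e; subst.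
  by congr (_, (_, _)); apply: val_inj => /=; lia.
have h1 : Q M M <= _ := fiber_sum_parallelogram s (fun x => K1 x + K2 x) H.
have h2 := fiber_sum_parallelogram s K1 K2.
rewrite -/(Q K1 K1) -/(Q K2 K2) in h2; rewrite -/(Q H H) QH in h1.
rewrite EQ QDD; lra.
Qed.

Lemma self_energyZ (R : realType) (T : finType) (par : rel (T * T)) (c : R)
    (f : T -> R) :
  self_energy par (fun i => c * f i) = c ^+ 4 * self_energy par f.
Proof.
by rewrite /self_energy /energy big_distrr /=; apply: eq_bigr => q _; ring.
Qed.

(** One of the two sides of the threshold has at most half of the mass; apply
    [energy_spread] to it after normalization. *)
Lemma energy_gain (R : realType) (n : nat) (m : nat) (b : R) (z : 'I_n -> R) :
  (forall i, 0 <= z i) -> 0 <= b ->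
  b * (\sum_i z i ^+ 4) <= \sum_(i : 'I_n | (i <= m)%N) z i ^+ 4 ->
  b * (\sum_i z i ^+ 4) <= \sum_(i : 'I_n | (m < i)%N) z i ^+ 4 ->
  self_energy (same_sum n) (fun i => z i ^+ 3) <=
    (\sum_i z i ^+ 4) ^+ 3 * (1 - b ^+ 4 / 64).
Proof.
move=> z0 b0; set W := \sum_i _ => lo hi.
have z40 i : 0 <= z i ^+ 4 by rewrite exprn_ge0.
have W0 : 0 <= W by apply: sumr_ge0 => i _.
have [WZ|Wn0] := eqVneq W 0.
  have zz i : z i = 0.
    have /eqP := WZ; rewrite psumr_eq0 => [/allP/(_ i)|//].
    by rewrite mem_index_enum => /(_ isT) /=; rewrite expf_eq0 => /eqP.
  rewrite WZ expr0n mul0r /self_energy /energy big1 // => q _.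
  by rewrite zz expr0n !mul0r.
have Wp : 0 < W by rewrite lt_neqAle eq_sym Wn0.
pose rho := W `^ 4^-1.
have rho0 : 0 < rho by rewrite powR_gt0.
have rho4 : rho ^+ 4 = W.
  by rewrite -powR_mulrn ?ltW // -powRrM mulVf ?pnatr_eq0 // powRr1.
pose y i := z i / rho.
have y4 i : y i ^+ 4 = z i ^+ 4 / W by rewrite /y exprMn exprVn rho4.
have y0 i : 0 <= y i by rewrite divr_ge0 // ltW.
have ysum : \sum_i y i ^+ 4 = 1.
  by under eq_bigr do rewrite y4; rewrite -big_distrl /= divff.
have -> : self_energy (same_sum n) (fun i => z i ^+ 3) =
    W ^+ 3 * self_energy (same_sum n) (fun i => y i ^+ 3).
  rewrite -rho4 -exprM mulnC exprM -self_energyZ; congr self_energy.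
  by apply/funext => i; rewrite -exprMn /y mulrC divfK ?gt_eqF.
rewrite ler_pM2l ?exprn_gt0 //.
have fin (q : R) : b <= q -> 1 - q ^+ 4 / 64 <= 1 - b ^+ 4 / 64.
  by move=> bq; rewrite lerB // ler_wpM2r // lerXn2r // nnegrE (le_trans b0).
pose L := \sum_(i : 'I_n | (i <= m)%N) y i ^+ 4.
pose U := \sum_(i : 'I_n | (m < i)%N) y i ^+ 4.
have LU : L + U = 1.
  rewrite -ysum (bigID (fun i : 'I_n => (i <= m)%N)) /=; congr (_ + _).
  by apply: eq_bigl => i; rewrite -ltnNge.
have bL : b <= L.
  by rewrite /L; under eq_bigr do rewrite y4; rewrite -big_distrl /= ler_pdivlMr.
have bU : b <= U.
  by rewrite /U; under eq_bigr do rewrite y4; rewrite -big_distrl /= ler_pdivlMr.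
have [Ule|Ugt] := leP U (1 / 2).
  apply: (le_trans _ (fin _ bU)).
  apply: (@energy_spread _ _ (fun i : 'I_n => (m < i)%N)
    (fun i j : 'I_n => (i <= j)%N)) => //.
  - by clear => i j; lia.
  - by clear => i j k l e; lia.
have Lle : L <= 1 / 2 by move: LU Ugt; move: (L) (U) => L' U'; lra.
apply: (le_trans _ (fin _ bL)).
apply: (@energy_spread _ _ (fun i : 'I_n => (i <= m)%N)
  (fun i j : 'I_n => (j <= i)%N)) => //.
- by clear => i j; lia.
- by clear => i j; lia.
Qed.

(** Young's inequality is the case of a vacuous threshold. *)
Lemma energy_young (R : realType) (n : nat) (z : 'I_n -> R) :
  (forall i, 0 <= z i) ->
  self_energy (same_sum n) (fun i => z i ^+ 3) <= (\sum_i z i ^+ 4) ^+ 3.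
Proof.
move=> z0; have := @energy_gain R n 0 0 z z0 (lexx 0).
rewrite !mul0r expr0n mul0r subr0 mulr1; apply.
  by apply: sumr_ge0 => i _; rewrite exprn_ge0.
by apply: sumr_ge0 => i _; rewrite exprn_ge0.
Qed.

(** * Powers of weights, and the case of a dominant atom *)

Lemma powR_le_tangent (R : realType) (y th : R) :
  0 <= y -> 0 < th <= 1 -> y `^ th <= 1 + th * (y - 1).
Proof.
rewrite le_eqVlt => /orP[/eqP<-|y0] /andP[th0 th1].
  by rewrite powR0 ?gt_eqF //; lra.
rewrite /powR gt_eqF //; set L := ln y.
have yE : y = expR L by rewrite lnK.
set z := expR (th * L).
have z0 : 0 <= z by apply: expR_ge0.
have h1 : z * (1 + (L - th * L)) <= y.
  have -> : y = z * expR (L - th * L) by rewrite -expRD yE; congr expR; ring.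
  by rewrite ler_wpM2l // expR_ge1Dx.
have h2 : z * (1 + - (th * L)) <= 1.
  have e1 : z * expR (- (th * L)) = 1 by rewrite -expRD subrr expR0.
  rewrite -[leRHS]e1.
  by rewrite ler_wpM2l // expR_ge1Dx.
have k1 : th * (z * (1 + (L - th * L))) <= th * y by rewrite ler_wpM2l // ltW.
have k2 : (1 - th) * (z * (1 + - (th * L))) <= (1 - th) * 1.
  by rewrite ler_wpM2l // subr_ge0.
have -> : z = th * (z * (1 + (L - th * L))) + (1 - th) * (z * (1 + - (th * L))).
  ring.
lra.
Qed.

(** Hoelder's inequality, proved by comparing the concave power with its tangent
    at the mean value of g. *)
Lemma sum_powR_le (R : realType) (n : nat) (g : 'I_n -> R) (th : R) :
  (0 < n)%N -> (forall i, 0 <= g i) -> 0 < th <= 1 ->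
  \sum_i g i `^ th <= n%:R `^ (1 - th) * (\sum_i g i) `^ th.
Proof.
move=> n0 g0 /andP[th0 th1]; set G := \sum_i g i.
have n0' : (0 : R) < n%:R by rewrite ltr0n.
have G0 : 0 <= G by apply: sumr_ge0.
have [GZ|Gn0] := eqVneq G 0.
  rewrite big1 ?mulr_ge0 ?powR_ge0 // => i _.
  have /eqP := GZ; rewrite psumr_eq0 => [/allP/(_ i)|//].
  by rewrite mem_index_enum => /(_ isT) /= /eqP ->; rewrite powR0 // gt_eqF.
have Gp : 0 < G by rewrite lt_neqAle eq_sym Gn0.
have gE i : g i `^ th <= (G / n%:R) `^ th * (1 + th * (g i * (n%:R / G) - 1)).
  have a1 : 0 <= G / n%:R by rewrite divr_ge0 // ltW.
  have a2 : 0 <= g i * (n%:R / G) by rewrite mulr_ge0 // divr_ge0 // ltW.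
  have -> : g i `^ th = (G / n%:R) `^ th * (g i * (n%:R / G)) `^ th.
    by rewrite -powRM //; congr (_ `^ _); field; rewrite !gt_eqF.
  rewrite ler_wpM2l ?powR_ge0 //.
  by apply: powR_le_tangent => //; rewrite th0.
apply: le_trans (ler_sum _ (fun i _ => gE i)) _.
rewrite -mulr_sumr big_split /= -mulr_sumr big_split /= -mulr_suml -/G.
rewrite !sumr_const card_ord.
have -> : G * (n%:R / G) = n%:R by field; rewrite gt_eqF.
have -> : (-1 : R) *+ n = - n%:R by rewrite mulNrn.
rewrite subrr mulr0 addr0 powRM ?invr_ge0 //.
have -> : n%:R^-1 `^ th = n%:R `^ (- th) :> R.
  by rewrite -powR_inv1 ?ltW // -powRrM mulN1r.
have nn0 : n%:R != 0 :> R by rewrite gt_eqF.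
rewrite powRD; last by rewrite nn0 implybT.
rewrite powRr1; last exact: ltW.
by rewrite le_eqVlt; apply/orP; left; apply/eqP; ring.
Qed.

Lemma cube_sum_powR_le (R : realType) (n : nat) (g : 'I_n -> R) (t : R) :
  (0 < n)%N -> (forall i, 0 <= g i) -> 0 < t <= 3 ->
  (\sum_i g i `^ (t / 3)) ^+ 3 <= n%:R `^ (3 - t) * (\sum_i g i) `^ t.
Proof.
move=> n0 g0 /andP[t0 t3].
have h : \sum_i g i `^ (t / 3) <= n%:R `^ (1 - t / 3) * (\sum_i g i) `^ (t / 3).
  by apply: sum_powR_le => //; apply/andP; split; lra.
apply: le_trans (lerXn2r 3 _ _ h) _; rewrite ?nnegrE ?mulr_ge0 ?powR_ge0 //.
  by apply: sumr_ge0 => i _; exact: powR_ge0.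
rewrite exprMn -!powR_mulrn ?powR_ge0 // -!powRrM.
have -> : (1 - t / 3) * 3 = 3 - t by lra.
by have -> : t / 3 * 3 = t by lra.
Qed.

Lemma self_energy_powR_le (R : realType) (n : nat) (g : 'I_n -> R) (t : R) :
  (0 < n)%N -> (forall i, 0 <= g i) -> 0 < t <= 3 ->
  self_energy (same_sum n) (fun i => g i `^ (t / 4)) <=
    n%:R `^ (3 - t) * (\sum_i g i) `^ t.
Proof.
move=> n0 g0 t03; apply: le_trans (cube_sum_powR_le n0 g0 t03).
have z4 i : (g i `^ (t / 12)) ^+ 4 = g i `^ (t / 3).
  by rewrite -powR_mulrn ?powR_ge0 // -powRrM; congr (_ `^ _); field.
under [X in _ <= X ^+ 3]eq_bigr do rewrite -z4.
have -> : (fun i => g i `^ (t / 4)) = (fun i => (g i `^ (t / 12)) ^+ 3).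
  apply/funext => i.
  by rewrite -powR_mulrn ?powR_ge0 // -powRrM; congr (_ `^ _); field.
by apply: energy_young => i; exact: powR_ge0.
Qed.

(** If eta is the mass outside the atom, the squares of [energy_near_atom] sum to
    at most eta^(t/2), which is at most eta / 8 because t/2 >= 5/4 and
    eta^(1/4) <= 1/8, and the energy of the rest is at most 2 eta^t.  Their
    total is below 2 eta <= (1 + eta)^t - 1. *)
Lemma energy_atom (R : realType) (n : nat) (g : 'I_n -> R) (t : R) (x0 : 'I_n) :
  (0 < n)%N -> (forall i, 0 <= g i) -> 5 / 2 <= t <= 3 -> n%:R `^ (3 - t) <= 2 ->
  g x0 = 1 -> \sum_(i | i != x0) g i <= (1 / 8) ^+ 4 ->
  self_energy (same_sum n) (fun i => g i `^ (t / 4)) <= (\sum_i g i) `^ t.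
Proof.
move=> n0 g0 /andP[t2 t3] nt gx0; set eta := \sum_(i | _) _ => eta8.
have eta0 : 0 <= eta by apply: sumr_ge0.
pose g' i := if i == x0 then 0 else g i.
have g'0 i : 0 <= g' i by rewrite /g'; case: ifP.
have g'sum : \sum_i g' i = eta.
  rewrite /eta [RHS]big_mkcond; apply: eq_bigr => i _; rewrite /g'.
  by case: (i == x0).
have eta1 : eta <= 1 by apply: le_trans eta8 _; lra.
have etat : eta `^ t <= eta ^+ 2.
  have [->|en0] := eqVneq eta 0; first by rewrite powR0 ?expr0n // gt_eqF //; lra.
  have ep : 0 < eta by rewrite lt_neqAle eq_sym en0.
  have -> : t = 2%:R * (t / 2) by lra.
  rewrite powRrM powR_mulrn //; apply: ge1r_powR; last by lra.
  by rewrite exprn_gt0 //= exprn_ile1.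
have E' : self_energy (same_sum n) (fun i => g' i `^ (t / 4)) <= 2 * eta ^+ 2.
  apply: le_trans (self_energy_powR_le n0 g'0 _) _; first by apply/andP; split; lra.
  by rewrite g'sum ler_pM ?powR_ge0.
have B : \sum_(i | i != x0) (g i `^ (t / 4)) ^+ 2 <= eta / 8.
  rewrite /eta big_distrl /=; apply: ler_sum => i ix0.
  have [->|gn0] := eqVneq (g i) 0.
    by rewrite powR0 ?expr0n ?mul0r // gt_eqF //; lra.
  have gp : 0 < g i by rewrite lt_neqAle eq_sym gn0 g0.
  have gle : g i <= (1 / 8) ^+ 4.
    apply: le_trans eta8; rewrite /eta (bigD1 i) //= lerDl.
    by apply: sumr_ge0.
  have g1 : g i <= 1 by apply: le_trans gle _; lra.
  rewrite -powR_mulrn ?powR_ge0 // -powRrM.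
  have -> : t / 4 * 2%:R = (1 + 4^-1) * (2 * t / 5) by field.
  rewrite powRrM.
  have pE : g i `^ (1 + 4^-1) = g i * g i `^ 4^-1.
    by rewrite powRD ?gn0 ?implybT // powRr1.
  have q8 : g i `^ 4^-1 <= 1 / 8.
    have -> : (1 / 8 : R) = ((1 / 8) ^+ 4) `^ 4^-1.
      rewrite -powR_mulrn; last by lra.
      by rewrite -powRrM divff ?pnatr_eq0 // powRr1 //; lra.
    by rewrite ge0_ler_powR ?nnegrE //; lra.
  have p1 : g i `^ (1 + 4^-1) <= g i / 8.
    by rewrite pE ler_wpM2l //; lra.
  apply: le_trans p1; apply: ge1r_powR; last by lra.
  rewrite powR_gt0 //=.
  by rewrite pE mulr_ile1 ?powR_ge0 //; lra.
have := @energy_near_atom R n x0 (fun i => g i `^ (t / 4)).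
rewrite gx0 powR1; move=> /(_ (fun i => powR_ge0 _ _) erefl).
have -> : (fun i => if i == x0 then 0 else g i `^ (t / 4)) =
   (fun i => g' i `^ (t / 4)).
  apply/funext => i; rewrite /g'; case: eqP => // _.
  by rewrite powR0 // gt_eqF //; lra.
move=> h; apply: le_trans h _.
rewrite [X in _ <= X `^ t](bigD1 x0) //= gx0 -/eta.
have lb : (1 + eta) ^+ 2 <= (1 + eta) `^ t.
  rewrite -powR_mulrn; last by lra.
  by apply: ler_powR; lra.
apply: le_trans lb.
have eta2 : eta ^+ 2 <= eta * (1 / 8) by rewrite expr2 ler_wpM2l //; lra.
have := sqr_ge0 eta.
lra.
Qed.

(** * The energy inequality on an interval and on products *)

(** The power t/4 makes both sides homogeneous of degree t in g and turns the
    indicator of a set into itself; an inequality for all weights, unlike one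
    for sets only, passes to products. *)
Definition energy_bound (R : realType) (T : finType) (par : rel (T * T))
    (t : R) : Prop :=
  forall g : T -> R, (forall x, 0 <= g x) ->
    self_energy par (fun x => g x `^ (t / 4)) <= (\sum_x g x) `^ t.

Lemma self_energy_powRZ (R : realType) (T : finType) (par : rel (T * T))
    (g : T -> R) (c t : R) :
  0 <= c -> (forall x, 0 <= g x) ->
  self_energy par (fun x => (c * g x) `^ (t / 4)) =
    c `^ t * self_energy par (fun x => g x `^ (t / 4)).
Proof.
move=> c0 g0.
have -> : c `^ t = (c `^ (t / 4)) ^+ 4.
  by rewrite -powR_mulrn ?powR_ge0 // -powRrM; congr (_ `^ _); field.
rewrite -self_energyZ; congr self_energy; apply/funext => x.
by rewrite powRM.
Qed.

Lemma energy_bound_scale (R : realType) (T : finType) (par : rel (T * T))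
    (g : T -> R) (c t : R) :
  0 < c -> (forall x, 0 <= g x) ->
  self_energy par (fun x => (c * g x) `^ (t / 4)) <= (\sum_x c * g x) `^ t ->
  self_energy par (fun x => g x `^ (t / 4)) <= (\sum_x g x) `^ t.
Proof.
move=> c0 g0; have c0' := ltW c0.
rewrite self_energy_powRZ // -mulr_sumr powRM ?sumr_ge0 //.
by rewrite ler_pM2l // powR_gt0.
Qed.

(** If no threshold leaves at least this mass on both sides, then all the mass
    but twice this value lies at one point.  The value is a quarter of the bound
    in [energy_atom], which leaves room for dividing by the mass of the atom. *)
Definition atom_gap (R : realType) : R := (1 / 8) ^+ 4 / 4.
Arguments atom_gap R : clear implicits.

(** Take the smallest threshold m below which (inclusively) there is mass at
    least [atom_gap].  Either enough mass remains above m, and the gain of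
    [energy_gain] pays for the factor C lost in replacing the exponent 3 by t, or
    m is a dominant atom. *)
Lemma energy_bound_line (R : realType) (n : nat) (t C : R) :
  (0 < n)%N -> 5 / 2 <= t <= 3 -> n%:R `^ (3 - t) <= C -> C <= 2 ->
  C * (1 - (atom_gap R / 2) ^+ 4 / 64) <= 1 ->
  energy_bound (same_sum n) t.
Proof.
move=> n0 /andP[t2 t3] nC C2 Cgap g g0; set G := \sum_i g i.
have G0 : 0 <= G by apply: sumr_ge0.
have t0 : 0 < t by lra.
have t03 : 0 < t <= 3 by apply/andP; split.
have [GZ|Gn0] := eqVneq G 0.
  by apply: le_trans (self_energy_powR_le n0 g0 t03) _; rewrite -/G GZ powR0 ?mulr0 // gt_eqF.
have Gp : 0 < G by rewrite lt_neqAle eq_sym Gn0.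
apply: (@energy_bound_scale _ _ _ _ G^-1) => //; first by rewrite invr_gt0.
pose x i := G^-1 * g i; rewrite -/(x _).
have x0 i : 0 <= x i by rewrite mulr_ge0 // invr_ge0.
have xsum : \sum_i x i = 1 by rewrite -mulr_sumr mulVf.
rewrite -[X in self_energy _ X]/(fun i => x i `^ (t / 4)) -[X in X `^ t]/(\sum_i x i).
have xle1 i : x i <= 1.
  by rewrite -xsum (bigD1 i) //= lerDl sumr_ge0.
have xpow i : x i <= x i `^ (t / 3).
  have [->|xn0] := eqVneq (x i) 0; first exact: powR_ge0.
  by apply: ger1_powR; rewrite ?xle1 ?andbT ?lt_neqAle 1?eq_sym ?xn0 //=; lra.
set e := atom_gap R in Cgap.
have eE : e = (1 / 8) ^+ 4 / 4 by [].
have e0 : 0 < e by rewrite eE divr_gt0 ?exprn_gt0 //; lra.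
have exm : exists m, e <= \sum_(i : 'I_n | (i <= m)%N) x i.
  exists n; rewrite (eq_bigl xpredT) ?xsum; first by rewrite eE; lra.
  by move=> i; rewrite ltnW.
case: (ex_minnP exm) => m lo mmin.
have [hi|hi] := leP e (\sum_(i : 'I_n | (m < i)%N) x i).
  have W3 := cube_sum_powR_le n0 x0 t03.
  rewrite xsum powR1 mulr1 in W3.
  set W := \sum_i _ in W3.
  have W0 : 0 <= W by apply: sumr_ge0 => i _; exact: powR_ge0.
  have W2 : W <= 2.
    have : W ^+ 3 <= 2 ^+ 3 by apply: le_trans W3 _; lra.
    by rewrite ler_pXn2r ?nnegrE.
  have z4 i : (x i `^ (t / 12)) ^+ 4 = x i `^ (t / 3).
    by rewrite -powR_mulrn ?powR_ge0 // -powRrM; congr (_ `^ _); field.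
  have -> : (fun i => x i `^ (t / 4)) = (fun i => (x i `^ (t / 12)) ^+ 3).
    apply/funext => i.
    by rewrite -powR_mulrn ?powR_ge0 // -powRrM; congr (_ `^ _); field.
  have WE : \sum_i (x i `^ (t / 12)) ^+ 4 = W by apply: eq_bigr => i _.
  have bW : e / 2 * W <= e.
    have : e / 2 * W <= e / 2 * 2 by rewrite ler_wpM2l //; lra.
    lra.
  have := @energy_gain R n m (e / 2) (fun i => x i `^ (t / 12)).
  rewrite WE => h; rewrite xsum powR1; apply: le_trans (h _ _ _ _) _.
  - by move=> i; exact: powR_ge0.
  - lra.
  - apply: le_trans bW (le_trans lo _); apply: ler_sum => i _; by rewrite z4.
  - apply: le_trans bW (le_trans hi _); apply: ler_sum => i _; by rewrite z4.
  apply: le_trans Cgap; rewrite ler_wpM2r //; last exact: le_trans nC.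
  have : (e / 2) ^+ 4 <= 1 by rewrite exprn_ile1 //; rewrite eE; lra.
  lra.
have mn : (m < n)%N.
  suff : (m <= n.-1)%N by rewrite -[X in _ -> (_ < X)%N](prednK n0) ltnS.
  apply: mmin; rewrite (eq_bigl xpredT) ?xsum; first by rewrite eE; lra.
  by move=> i; rewrite -ltnS (prednK n0) ltn_ord.
pose x1 := Ordinal mn.
have lo' : \sum_(i : 'I_n | (i < m)%N) x i < e.
  case: (m) mmin => [|m'] mmin; first by rewrite big_pred0.
  rewrite ltNge; apply/negP => h.
  by have := mmin m' h; rewrite ltnn.
have rest : \sum_(i | i != x1) x i < 2 * e.
  rewrite (bigID (fun i : 'I_n => (i < m)%N)) /=.
  have -> : \sum_(i | (i != x1) && (i < m)%N) x i = \sum_(i : 'I_n | (i < m)%N) x i.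
    by apply: eq_bigl => i; rewrite -val_eqE /= ltn_neqAle andbA andbb.
  have -> : \sum_(i | (i != x1) && ~~ (i < m)%N) x i = \sum_(i : 'I_n | (m < i)%N) x i.
    by apply: eq_bigl => i; rewrite -val_eqE /= -leqNgt ltn_neqAle eq_sym.
  move: lo' hi; set a := (X in X < e -> _); set b := (X in _ -> X < e -> _).
  by rewrite -/a -/b; lra.
have x1E : x x1 = 1 - \sum_(i | i != x1) x i.
  by rewrite -xsum (bigD1 x1) //=; ring.
have rest0 : 0 <= \sum_(i | i != x1) x i by apply: sumr_ge0.
move: rest x1E rest0; set r := \sum_(i | i != x1) x i => rest x1E rest0.
have x1p : 0 < x x1 by rewrite x1E; rewrite eE in rest; lra.
apply: (@energy_bound_scale _ _ _ _ (x x1)^-1) => //; first by rewrite invr_gt0.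
apply: (@energy_atom _ _ _ _ x1) => //.
- by move=> i; rewrite mulr_ge0 // invr_ge0 ltW.
- by apply/andP; split.
- exact: le_trans nC C2.
- by rewrite mulVf // gt_eqF.
- rewrite -mulr_sumr -/r mulrC ler_pdivrMr // x1E.
  by move: rest; rewrite eE; lra.
Qed.

Lemma energy_powR_le (R : realType) (n : nat) (t : R) (g1 g2 g3 g4 : 'I_n -> R) :
  0 < t -> energy_bound (same_sum n) t ->
  (forall i, 0 <= g1 i) -> (forall i, 0 <= g2 i) ->
  (forall i, 0 <= g3 i) -> (forall i, 0 <= g4 i) ->
  energy (same_sum n) (fun i => g1 i `^ (t / 4)) (fun i => g2 i `^ (t / 4))
     (fun i => g3 i `^ (t / 4)) (fun i => g4 i `^ (t / 4)) <=
  (\sum_i g1 i) `^ (t / 4) * (\sum_i g2 i) `^ (t / 4) *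
  ((\sum_i g3 i) `^ (t / 4) * (\sum_i g4 i) `^ (t / 4)).
Proof.
move=> t0 bnd p1 p2 p3 p4.
have t4 : t / 4 != 0 by rewrite gt_eqF //; lra.
(* For g = 0 the quotient by the sum is meaningless, and f = 0 serves. *)
have norm g : (forall i, 0 <= g i) -> exists2 f : 'I_n -> R,
    forall i, g i `^ (t / 4) = (\sum_i g i) `^ (t / 4) * f i &
    self_energy (same_sum n) f <= 1.
  move=> g0; have G0 : 0 <= \sum_i g i by apply: sumr_ge0.
  have [GZ|Gn0] := eqVneq (\sum_i g i) 0.
    exists (fun=> 0) => [i|].
      have /eqP := GZ; rewrite psumr_eq0 => [/allP/(_ i)|//].
      by rewrite mem_index_enum => /(_ isT) /= /eqP ->; rewrite powR0 // mulr0.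
    by rewrite /self_energy /energy big1 // => q _; rewrite !mul0r.
  have Gp : 0 < \sum_i g i by rewrite lt_neqAle eq_sym Gn0.
  exists (fun i => (g i / \sum_i g i) `^ (t / 4)) => [i|].
    rewrite -powRM ?divr_ge0 //; congr (_ `^ _); field.
    by rewrite gt_eqF.
  have := bnd (fun i => g i / \sum_i g i).
  rewrite -mulr_suml divff // powR1; apply => i.
  by rewrite divr_ge0.
have [f1 e1 n1] := norm _ p1; have [f2 e2 n2] := norm _ p2.
have [f3 e3 n3] := norm _ p3; have [f4 e4 n4] := norm _ p4.
set c1 := _ `^ _; set c2 := _ `^ _; set c3 := _ `^ _; set c4 := _ `^ _.
have -> : energy (same_sum n) (fun i => g1 i `^ (t / 4)) (fun i => g2 i `^ (t / 4))
    (fun i => g3 i `^ (t / 4)) (fun i => g4 i `^ (t / 4)) =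
    c1 * c2 * (c3 * c4) * energy (same_sum n) f1 f2 f3 f4.
  rewrite /energy mulr_sumr; apply: eq_bigr => q _.
  by rewrite e1 e2 e3 e4 -/c1 -/c2 -/c3 -/c4; ring.
rewrite -[leRHS]mulr1 ler_wpM2l ?mulr_ge0 ?powR_ge0 //.
by apply: le_trans (energy_le_mean _ _ _ _) _; lra.
Qed.

Definition prod_par (X Y : finType) (p : rel (X * X)) (q : rel (Y * Y)) :
    rel ((X * Y) * (X * Y)) :=
  fun u v => p (u.1.1, u.2.1) (v.1.1, v.2.1) && q (u.1.2, u.2.2) (v.1.2, v.2.2).

(** Sum first over the coordinates in {0, ..., n-1} with the other coordinates
    fixed: by [energy_powR_le] this bounds the energy of g by that of its fibre
    sums. *)
Lemma energy_bound_prod (R : realType) (n : nat) (T : finType)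
    (par : rel (T * T)) (t : R) :
  0 < t -> energy_bound (same_sum n) t -> energy_bound par t ->
  energy_bound (prod_par (same_sum n) par) t.
Proof.
move=> t0 b1 b2 g g0.
pose G y := \sum_i g (i, y).
have G0 y : 0 <= G y by apply: sumr_ge0.
have -> : \sum_x g x = \sum_y G y.
  rewrite exchange_big pair_big /=; apply: eq_bigr => -[i y] _ //.
apply: le_trans (b2 G G0).
pose I4 := (('I_n * 'I_n) * ('I_n * 'I_n))%type.
pose T4 := ((T * T) * (T * T))%type.
pose h (q : T4 * I4) : (('I_n * T) * ('I_n * T)) * (('I_n * T) * ('I_n * T)) :=
  let: (((y1, y2), (y3, y4)), ((i1, i2), (i3, i4))) := q in
  (((i1, y1), (i2, y2)), ((i3, y3), (i4, y4))).
have hb : bijective h.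
  exists (fun q => let: (((i1, y1), (i2, y2)), ((i3, y3), (i4, y4))) := q in
    (((y1, y2), (y3, y4)), ((i1, i2), (i3, i4)))).
    by move=> [[[? ?] [? ?]] [[? ?] [? ?]]].
  by move=> [[[? ?] [? ?]] [[? ?] [? ?]]].
rewrite {1}/self_energy {1}/energy (reindex h); last exact: onW_bij.
have -> : \sum_(q | prod_par (same_sum n) par (h q).1 (h q).2)
    g (h q).1.1 `^ (t / 4) * g (h q).1.2 `^ (t / 4) *
    (g (h q).2.1 `^ (t / 4) * g (h q).2.2 `^ (t / 4)) =
  \sum_(y : T4 | par y.1 y.2) energy (same_sum n)
    (fun i => g (i, y.1.1) `^ (t / 4)) (fun i => g (i, y.1.2) `^ (t / 4))
    (fun i => g (i, y.2.1) `^ (t / 4)) (fun i => g (i, y.2.2) `^ (t / 4)).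
  rewrite /energy pair_big /=; apply: eq_big => q.
    by move: q => [[[? ?] [? ?]] [[? ?] [? ?]]]; rewrite /prod_par /= andbC.
  by move: q => [[[? ?] [? ?]] [[? ?] [? ?]]].
apply: ler_sum => y _.
exact: (energy_powR_le (g1 := fun i => g (i, y.1.1)) (g2 := fun i => g (i, y.1.2))
  (g3 := fun i => g (i, y.2.1)) (g4 := fun i => g (i, y.2.2))).
Qed.

(** * The upper bound *)

(** The set {0, ..., n-1}^d as an iterated product, the shape in which
    [energy_bound_prod] applies. *)
Fixpoint box (n d : nat) : finType :=
  if d is d'.+1 then ('I_n * box n d')%type else unit.

Fixpoint box_par (n d : nat) : rel (box n d * box n d) :=
  match d return rel (box n d * box n d) with
  | 0 => fun _ _ => true
  | d'.+1 => prod_par (same_sum n) (@box_par n d')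
  end.
Arguments box_par n d : clear implicits.

Fixpoint box_of (n d : nat) (x : nat -> 'I_n) : box n d :=
  match d return box n d with
  | 0 => tt
  | d'.+1 => (x 0%N, box_of d' (fun i => x i.+1))
  end.

Lemma box_of_inj (n d : nat) (x y : nat -> 'I_n) :
  box_of d x = box_of d y -> forall i, (i < d)%N -> x i = y i.
Proof.
elim: d x y => [|d IH] x y //= [h0 h1] [|i] // id.
exact: (IH (fun i => x i.+1) (fun i => y i.+1)).
Qed.

Lemma box_of_par (n d : nat) (x y z w : nat -> 'I_n) :
  (forall i, (i < d)%N -> (x i + y i = z i + w i)%N) ->
  box_par n d (box_of d x, box_of d y) (box_of d z, box_of d w).
Proof.
elim: d x y z w => [|d IH] x y z w //= h.
rewrite /prod_par /=; apply/andP; split; first by rewrite /same_sum /= h.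
apply: (IH (fun i => x i.+1) (fun i => y i.+1) (fun i => z i.+1)
  (fun i => w i.+1)) => i id; exact: h.
Qed.

Lemma energy_bound_box (R : realType) (n d : nat) (t : R) :
  0 < t -> energy_bound (same_sum n) t -> energy_bound (box_par n d) t.
Proof.
move=> t0 b1; elim: d => [|d IH]; last exact: energy_bound_prod.
move=> g g0 /=.
have -> : \sum_x g x = g tt by rewrite (big_pred1 tt) //; case.
rewrite /self_energy /energy (big_pred1 ((tt, tt), (tt, tt))).
  have -> : g tt `^ t = (g tt `^ (t / 4)) ^+ 4.
    by rewrite -powR_mulrn ?powR_ge0 // -powRrM; congr (_ `^ _); field.
  by rewrite /= le_eqVlt; apply/orP; left; apply/eqP; ring.
by move=> [[[] []] [[] []]].
Qed.

Definition quads (d : nat) (A : {fset 'rV[int]_d}) : nat :=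
  #|[pred q : (A * A) * (A * A) |
      val q.1.1 + val q.1.2 == val q.2.1 + val q.2.2]|.

(** Code the points of A by [box_of] and apply the energy inequality to the
    indicator of the image. *)
Lemma quads_le (R : realType) (n d : nat) (A : {fset 'rV[int]_d}) (t : R) :
  0 < t -> energy_bound (same_sum n.+1) t -> in_box n.+1 A ->
  (quads A)%:R <= (#|` A|%fset)%:R `^ t.
Proof.
move=> t0 b1 boxA.
pose coord (v : 'rV[int]_d) (i : nat) : 'I_n.+1 :=
  if (insub i : option 'I_d) is Some j then inord (absz (v 0 j)) else ord0.
have coordE (a : A) (j : 'I_d) : (coord (val a) j : nat)%:Z = (val a : 'rV[int]_d) 0 j.
  rewrite /coord valK /=.
  have /andP[h0 h1] := boxA _ (valP a) j.
  rewrite inordK ?gez0_abs //.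
  by rewrite -ltz_nat gez0_abs.
pose c (a : A) := box_of d (coord (val a)).
have cinj : injective c.
  move=> a b /box_of_inj h; apply: val_inj; apply/rowP => j.
  by rewrite -!coordE (h j).
pose g (y : box n.+1 d) : R := (y \in codom c)%:R.
have g0 y : 0 <= g y by rewrite ler0n.
have gc a : g (c a) = 1 by rewrite /g codom_f.
have gsum : \sum_y g y = (#|` A|%fset)%:R.
  rewrite /g -natr_sum cardfE -(card_codom cinj) -sum1_card [in RHS]big_mkcond.
  by congr (_%:R); apply: eq_bigr => y _; case: (y \in _).
have bnd := energy_bound_box (d := d) t0 b1 g0.
rewrite -gsum; apply: (le_trans _ bnd).
rewrite /quads -sum1_card natr_sum.
pose phi (q : (A * A) * (A * A)) := ((c q.1.1, c q.1.2), (c q.2.1, c q.2.2)).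
pose F (q : (box n.+1 d * box n.+1 d) * (box n.+1 d * box n.+1 d)) : R :=
  g q.1.1 `^ (t / 4) * g q.1.2 `^ (t / 4) *
  (g q.2.1 `^ (t / 4) * g q.2.2 `^ (t / 4)).
under eq_bigr => q _.
  have -> : 1%:R = F (phi q) by rewrite /F /phi /= !gc powR1 !mul1r.
  over.
apply: (@sum_le_inj R _ _ phi _
  (fun q => box_par n.+1 d q.1 q.2) F).
- by move=> q; rewrite /F !mulr_ge0 ?powR_ge0.
- move=> [[a1 a2] [a3 a4]] [[b1' b2] [b3 b4]] _ _ /= [].
  by do 4 move=> /cinj ->.
- move=> [[a1 a2] [a3 a4]] /eqP /= e; apply: box_of_par => i id.
  have := congr1 (fun v : 'rV[int]_d => v 0 (Ordinal id)) e.
  rewrite !mxE -!coordE /=; lia.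
Qed.

(** The vertices a, a + h_0, a + h_1, a + h_0 + h_1 form an additive quadruple,
    and each other direction h_i is determined by the vertex a + h_i of A. *)
Lemma P_le_quads (d k : nat) (A : {fset 'rV[int]_d}) :
  (P_ k.+2 A <= quads A * #|` A|%fset ^ k)%N.
Proof.
pose Q := {q : (A * A) * (A * A) | val q.1.1 + val q.1.2 == val q.2.1 + val q.2.2}.
pose T : finType := (Q * {ffun 'I_k -> A})%type.
have cardT : #|T| = (quads A * #|` A|%fset ^ k)%N.
  by rewrite card_prod card_ffun card_ord -cardfE card_sig.
pose G (u : T) : 'rV[int]_d * {ffun 'I_k.+2 -> 'rV[int]_d} :=
  let q := val u.1 in
  (val q.1.1, [ffun i : 'I_(2 + k) => match fintype.split i with
     | inl j => (if j == ord0 then val q.2.1 else val q.2.2) - val q.1.1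
     | inr j => val (u.2 j) - val q.1.1 end]).
have cover : cubes k.+2 A `<=` range G.
  move=> [a h] /= H.
  have aA : a \in A.
    have := H [ffun=> false]; rewrite big1 ?addr0 // => i _.
    by rewrite ffunE mulr0n.
  have hA i : a + h i \in A.
    have := H [ffun j => j == i]; rewrite (bigD1 i) //= ffunE eqxx mulr1n.
    rewrite big1 ?addr0 // => j /negbTE ji.
    by rewrite ffunE ji mulr0n.
  pose i0 : 'I_k.+2 := ord0; pose i1 : 'I_k.+2 := lift ord0 ord0.
  have hhA : a + (h i0 + h i1) \in A.
    have := H [ffun j => (j == i0) || (j == i1)].
    rewrite (bigD1 i0) //= ffunE eqxx mulr1n (bigD1 i1) //= ffunE eqxx orbT mulr1n.
    rewrite big1 ?addr0 // => j /andP[/negbTE j0 /negbTE j1].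
    by rewrite ffunE j0 j1 mulr0n.
  pose q : (A * A) * (A * A) :=
    (([` aA], [` hhA]), ([` hA i0], [` hA i1]))%fset.
  have qP : val q.1.1 + val q.1.2 == val q.2.1 + val q.2.2.
    by rewrite /= [eqbRHS]addrACA -addrA.
  exists (exist _ q qP, [ffun j => [` hA (rshift 2 j)]%fset]) => //.
  congr pair; apply/ffunP => i; rewrite ffunE /=.
  case: fintype.splitP => j ij.
    have [j0|j0] := eqVneq j ord0.
      have -> : i = i0 by apply: val_inj; rewrite /= ij j0.
      by rewrite addrC addKr.
    have -> : i = i1.
      apply: val_inj => /=; rewrite ij; move: j0; rewrite -val_eqE /=.
      by have := ltn_ord j; case: (val j) => [|[|]].
    by rewrite addrC addKr.
  rewrite ffunE /= addrC addKr; congr (h _); apply: val_inj => /=.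
  by rewrite ij.
rewrite -cardT /P_.
have sub : (fset_set (cubes k.+2 A) `<=` [fset G u | u in {: T}])%fset.
  apply/fsubsetP => u; rewrite in_fset_set; last exact: finite_cubes.
  by rewrite inE => /cover [v _ <-]; apply/imfsetP; exists v.
apply: leq_trans (fsubset_leq_card sub) _.
by apply: leq_trans (leq_imfset_card _ _ _) _; rewrite cardE.
Qed.

Lemma admissible_of_energy_bound (R : realType) (n k : nat) (t : R) :
  0 < t -> energy_bound (same_sum n.+1) t ->
  admissible_exponent k.+2 n.+1 (t + k%:R).
Proof.
move=> t0 b1; split; first by rewrite ltr_wpDr.
move=> d d0 A boxA.
apply: (@le_trans _ _ ((quads A * #|` A|%fset ^ k)%N%:R)).
  by rewrite ler_nat P_le_quads.
rewrite powRD; last by rewrite gt_eqF // ltr_wpDr.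
rewrite natrM natrX powR_mulrn // ler_wpM2r ?exprn_ge0 //.
exact: (quads_le t0 b1 boxA).
Qed.

(** With t = 3 - c / log2 n the loss n^(3-t) = 2^c must not exceed
    C = 1 / (1 - gam), where gam is the gain in Young's inequality; c <= 1/2 keeps t above 5/2. *)
Lemma tkn_upper (R : realType) : exists c : R, 0 < c /\
  forall k n : nat, (2 <= k)%N -> (2 <= n)%N ->
    tkn R k n <= k.+1%:R - c / log2 (n%:R : R).
Proof.
pose gam : R := (atom_gap R / 2) ^+ 4 / 64.
have gE : gam = (((1 / 8) ^+ 4 / 4) / 2) ^+ 4 / 64 by [].
have gam0 : 0 < gam by rewrite gE; rewrite !(divr_gt0, exprn_gt0) //; lra.
have gam1 : gam <= 1 / 2.
  have : (((1 / 8) ^+ 4 / 4) / 2 : R) ^+ 4 <= 1 by rewrite exprn_ile1 //; lra.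
  by rewrite gE; lra.
have ln2 : 0 < ln (2 : R) by rewrite ln_gt0 // ltr1n.
pose C : R := (1 - gam)^-1.
have C0 : 0 < C by rewrite invr_gt0; lra.
have C1 : 1 < C by rewrite invf_gt1; lra.
have C2 : C <= 2 by rewrite -[X in _ <= X]invrK lef_pV2 ?posrE ?invr_gt0 //; lra.
pose c : R := Num.min (1 / 2) (ln C / ln 2).
have c0 : 0 < c.
  by rewrite lt_min; apply/andP; split; [lra | exact: divr_gt0 (ln_gt0 C1) ln2].
have c1 : c <= 1 / 2 by rewrite ge_min lexx.
have cC : c * ln 2 <= ln C by rewrite -ler_pdivlMr // ge_min lexx orbT.
exists c; split=> // k n; case: k => [//|[//|k]] _; case: n => [//|n] n2.
have lnn : ln 2 <= ln n.+1%:R :> R.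
  by rewrite ler_ln ?posrE ?ltr0n // ler_nat.
have lnn0 : 0 < ln n.+1%:R :> R by apply: lt_le_trans lnn.
set kap := c / _.
have kapE : kap = c * ln 2 / ln n.+1%:R.
  by rewrite /kap /log2; field; rewrite !gt_eqF.
have kap0 : 0 <= kap by rewrite kapE divr_ge0 ?mulr_ge0 // ltW.
have kap1 : kap <= 1 / 2.
  by rewrite kapE ler_pdivrMr //; nra.
have nk : n.+1%:R `^ kap <= C.
  rewrite /powR gt_eqF ?ltr0n // kapE divfK ?gt_eqF //.
  by rewrite -[leRHS]lnK ?posrE // ler_expR.
have bnd : energy_bound (same_sum n.+1) (3 - kap).
  apply: (@energy_bound_line _ _ _ C) => //.
  - by apply/andP; split; lra.
  - by have -> : 3 - (3 - kap) = kap by ring.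
  - by rewrite -/gam mulVf //; lra.
have [_ small] := tkn_smallest R k.+2 n2.
have -> : k.+3%:R - kap = (3 - kap) + k%:R :> R.
  by rewrite -[k.+3]addn3 natrD; ring.
by apply: small; apply: admissible_of_energy_bound => //; lra.
Qed.

(** * Integer points of Euclidean balls *)

Definition dot (d : nat) (x y : 'rV[int]_d) : int := \sum_i x 0 i * y 0 i.

Lemma dotC (d : nat) (x y : 'rV[int]_d) : dot x y = dot y x.
Proof. by apply: eq_bigr => i _; rewrite mulrC. Qed.

Lemma dotDl (d : nat) (x y z : 'rV[int]_d) : dot (x + y) z = dot x z + dot y z.
Proof. by rewrite -big_split; apply: eq_bigr => i _; rewrite mxE mulrDl. Qed.

Lemma dotDr (d : nat) (x y z : 'rV[int]_d) : dot z (x + y) = dot z x + dot z y.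
Proof. by rewrite dotC dotDl !(dotC z). Qed.

Lemma dotZl (d : nat) (c : int) (x y : 'rV[int]_d) : dot (c *: x) y = c * dot x y.
Proof. by rewrite /dot mulr_sumr; apply: eq_bigr => i _; rewrite mxE mulrA. Qed.

Lemma dotZr (d : nat) (c : int) (x y : 'rV[int]_d) : dot x (c *: y) = c * dot x y.
Proof. by rewrite dotC dotZl dotC. Qed.

Lemma dot0l (d : nat) (y : 'rV[int]_d) : dot 0 y = 0.
Proof. by rewrite /dot big1 // => i _; rewrite mxE mul0r. Qed.

Lemma dot_suml (d : nat) (I : finType) (F : I -> 'rV[int]_d) (y : 'rV[int]_d) :
  dot (\sum_i F i) y = \sum_i dot (F i) y.
Proof.
exact: (big_morph (fun x => dot x y) (fun u v => dotDl u v y) (dot0l y)).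
Qed.

Lemma dot_sumr (d : nat) (I : finType) (F : I -> 'rV[int]_d) (y : 'rV[int]_d) :
  dot y (\sum_i F i) = \sum_i dot y (F i).
Proof. by rewrite dotC dot_suml; apply: eq_bigr => i _; rewrite dotC. Qed.

Lemma dotxx_ge0 (d : nat) (x : 'rV[int]_d) : 0 <= dot x x.
Proof. by apply: sumr_ge0 => i _; rewrite -expr2 sqr_ge0. Qed.

Lemma dot_triangle (d : nat) (u v : 'rV[int]_d) (r s : int) :
  0 < r -> 0 < s -> dot u u <= r ^+ 2 -> dot v v <= s ^+ 2 ->
  dot (u + v) (u + v) <= (r + s) ^+ 2.
Proof.
move=> r0 s0 ur vs.
have uv : dot u v <= r * s.
  have h := dotxx_ge0 (s *: u + (- r) *: v).
  rewrite dotDl !dotDr !dotZl !dotZr (dotC v u) in h.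
  have h1 : s ^+ 2 * dot u u <= s ^+ 2 * r ^+ 2 by rewrite ler_wpM2l ?sqr_ge0.
  have h2 : r ^+ 2 * dot v v <= r ^+ 2 * s ^+ 2 by rewrite ler_wpM2l ?sqr_ge0.
  rewrite -(ler_pM2l (mulr_gt0 r0 s0)).
  move: h h1 h2; move: (dot u u) (dot u v) (dot v v) => a b c; lra.
rewrite dotDl !dotDr (dotC v u); move: ur vs uv.
move: (dot u u) (dot u v) (dot v v) => a b c; lra.
Qed.

Lemma finite_zball (d r : nat) :
  finite_set [set x : 'rV[int]_d | dot x x <= r%:Z ^+ 2].
Proof.
pose g (m : 'rV['I_(r + r).+1]_d) : 'rV[int]_d :=
  \row_i ((m 0 i : nat)%:Z - r%:Z).
apply: (@sub_finite_set _ _ (range g)); last exact/finite_image/finite_finset.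
move=> x /= xr.
have xi i : `|x 0 i| <= r%:Z.
  rewrite -ler_sqr ?nnegrE // real_normK ?num_real //.
  apply: le_trans xr; rewrite /dot (bigD1 i) //= -expr2 lerDl.
  by apply: sumr_ge0 => j _; rewrite -expr2 sqr_ge0.
exists (\row_i inord (absz (x 0 i + r%:Z))) => //.
apply/rowP => i; rewrite !mxE.
have := xi i; rewrite ler_norml => /andP[h1 h2].
have h0 : 0 <= x 0 i + r%:Z by lra.
rewrite inordK; first by rewrite gez0_abs // addrK.
by rewrite ltnS -lez_nat gez0_abs // PoszD; lra.
Qed.

Definition zball (d r : nat) : {fset 'rV[int]_d} :=
  fset_set [set x : 'rV[int]_d | dot x x <= r%:Z ^+ 2].

Lemma in_zball (d r : nat) (x : 'rV[int]_d) :
  (x \in zball d r) = (dot x x <= r%:Z ^+ 2).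
Proof.
by rewrite in_fset_set; [apply/idP/idP; rewrite inE | exact: finite_zball].
Qed.

Lemma leq_card_pred_prod (X : finType) (T : choiceType) (F : finType)
    (P : pred X) (B : {fset T}) (phi : X -> T) (psi : X -> F) :
  (forall x, P x -> phi x \in B) ->
  (forall x y, P x -> P y -> phi x = phi y -> psi x = psi y -> x = y) ->
  (#|P| <= #|` B|%fset * #|F|)%N.
Proof.
move=> PB inj; rewrite [#|` B|%fset]cardfE -card_prod -card_sig.
pose f (a : {x | P x}) : B * F := ([` PB _ (valP a)]%fset, psi (val a)).
apply: (@leq_card _ _ f) => a b [] /= h1 h2; apply: val_inj.
exact: inj (valP a) (valP b) h1 h2.
Qed.

Lemma leq_card_fset_prod (T T' : choiceType) (F : finType) (A : {fset T})
    (B : {fset T'}) (phi : T -> T') (psi : T -> F) :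
  (forall x, x \in A -> phi x \in B) ->
  (forall x y, x \in A -> y \in A -> phi x = phi y -> psi x = psi y -> x = y) ->
  (#|` A|%fset <= #|` B|%fset * #|F|)%N.
Proof.
move=> AB inj; rewrite [#|` A|%fset]cardfE.
apply: (@leq_card_pred_prod A _ _ _ _ (phi \o val) (psi \o val)) => [x _|x y _ _].
  exact: AB (valP x).
by move=> h1 h2; apply: val_inj; apply: inj h1 h2; exact: valP.
Qed.

Definition zvol (d r : nat) : nat := #|` zball d r|%fset.

Lemma dot_le_box (d q : nat) (x : 'rV[int]_d) :
  (forall i, 0 <= x 0 i <= q%:Z) -> dot x x <= (q * d)%:Z ^+ 2.
Proof.
move=> h; apply: (@le_trans _ _ (\sum_(i < d) q%:Z ^+ 2)).
  apply: ler_sum => i _; rewrite -expr2; have /andP[h0 h1] := h i.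
  by rewrite ler_sqr ?nnegrE.
rewrite sumr_const card_ord PoszM exprMn -mulr_natr natz ler_wpM2l ?sqr_ge0 //.
by rewrite expr2 -PoszM lez_nat; case: (d) => // d'; rewrite leq_pmulr.
Qed.

(** Divide the coordinates by q with remainder: the quotient is x / q up to an
    error of norm at most sqrt d <= d, and there are q^d possible remainders. *)
Lemma zvol_scale (d q r : nat) : (0 < d)%N -> (0 < q)%N -> (0 < r)%N ->
  (zvol d (q * r) <= zvol d (r + d) * q ^ d)%N.
Proof.
case: q => [//|q] d0 _ r0.
have -> : (q.+1 ^ d = #|{ffun 'I_d -> 'I_q.+1}|)%N by rewrite card_ffun !card_ord.
pose phi (x : 'rV[int]_d) : 'rV[int]_d := \row_i divz (x 0 i) q.+1.
pose psi (x : 'rV[int]_d) : {ffun 'I_d -> 'I_q.+1} :=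
  [ffun i => inord (absz (modz (x 0 i) q.+1))].
have m0 (z : int) : 0 <= (z %% q.+1)%Z by rewrite modz_ge0.
have m1 (z : int) : (z %% q.+1)%Z < q.+1 by rewrite ltz_pmod.
apply: (@leq_card_fset_prod _ _ _ _ _ phi psi) => [x|x y _ _ /rowP h1 /ffunP h2].
  rewrite !in_zball => xr.
  pose rem : 'rV[int]_d := \row_i modz (x 0 i) q.+1.
  have e : q.+1%:Z *: phi x = x + (-1) *: rem.
    apply/rowP => i; rewrite !mxE mulN1r.
    by rewrite {2}(divz_eq (x 0 i) q.+1) mulrC addrK.
  have remle : dot ((-1) *: rem) ((-1) *: rem) <= (q.+1 * d)%:Z ^+ 2.
    rewrite dotZl dotZr mulrA mulN1r opprK mul1r.
    by apply: dot_le_box => i; rewrite mxE m0 ltW.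
  have := dot_triangle (r := (q.+1 * r)%:Z) (s := (q.+1 * d)%:Z) _ _ xr remle.
  rewrite -e !ltz_nat !muln_gt0 /= => /(_ r0 d0).
  rewrite dotZl dotZr mulrA -PoszD -mulnDr PoszM exprMn expr2.
  by rewrite ler_pM2l // mulr_gt0.
apply/rowP => i.
rewrite (divz_eq (x 0 i) q.+1) (divz_eq (y 0 i) q.+1).
have := h1 i; rewrite !mxE => ->; congr (_ + _).
have := congr1 (@nat_of_ord _) (h2 i); rewrite !ffunE !inordK.
- by move=> h; rewrite -(gez0_abs (m0 (x 0 i))) -(gez0_abs (m0 (y 0 i))) h.
- by rewrite -ltz_nat gez0_abs.
- by rewrite -ltz_nat gez0_abs.
Qed.

Lemma zvol_ge (d q : nat) : (q ^ d <= zvol d (q * d))%N.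
Proof.
case: q => [|q].
  case: d => [|d]; last by rewrite exp0n.
  rewrite cardfs_gt0; apply/fset0Pn; exists 0; rewrite in_zball dot0l //.
have -> : (q.+1 ^ d = #|{ffun 'I_d -> 'I_q.+1}|)%N by rewrite card_ffun !card_ord.
pose g (f : {ffun 'I_d -> 'I_q.+1}) : 'rV[int]_d := \row_i (f i : nat)%:Z.
have gP f : g f \in zball d (q.+1 * d).
  rewrite in_zball; apply: dot_le_box => i; rewrite mxE /= lez_nat.
  exact/ltnW/ltn_ord.
rewrite /zvol cardfE; apply: (@leq_card _ _ (fun f => [` gP f]%fset)).
move=> f f' [] /rowP h; apply/ffunP => i; apply: val_inj.
by have := h i; rewrite !mxE => -[].
Qed.

Lemma leq_zvol (d r s : nat) : (r <= s)%N -> (zvol d r <= zvol d s)%N.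
Proof.
move=> rs; apply/fsubset_leq_card/fsubsetP => x; rewrite !in_zball => h.
by apply: le_trans h _; rewrite ler_sqr ?nnegrE // lez_nat.
Qed.

(** * Growth of the number of integer points *)

Lemma zvol_le_multiple (d r s : nat) : (0 < d)%N -> (0 < s)%N ->
  (zvol d r <= zvol d (s + d) * (r %/ s).+1 ^ d)%N.
Proof.
move=> d0 s0; apply: leq_trans (zvol_scale d0 (ltn0Sn (r %/ s)) s0).
by apply: leq_zvol; rewrite ltnW // ltn_ceil.
Qed.

Lemma cvg_expr_1addV (R : realType) (c : R) (d : nat) :
  (1 + c / r%:R) ^+ d @[r --> \oo] --> (1 : R).
Proof.
have inv0 : (r%:R : R)^-1 @[r --> \oo] --> (0 : R).
  apply/(gtr0_cvgV0 (f := fun r : nat => (r%:R : R))); last exact: cvgr_idn.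
  by exists 1%N => // r /=; rewrite ltr0n.
have h : 1 + c / r%:R @[r --> \oo] --> (1 + c * 0 : R).
  by apply: cvgD; [exact: cvg_cst | apply: cvgM => //; exact: cvg_cst].
rewrite -[X in _ --> X](_ : (1 + c * 0) ^+ d = 1); last first.
  by rewrite mulr0 addr0 expr1n.
exact: (continuous_cvg _ (@exprn_continuous R d _) h).
Qed.

(** A subadditivity argument.  Put a(s) = N(s + d) / s^d and let V be the
    infimum of a over s >= 1 (the index in the proof is s - 1).  By definition
    N(r) >= V (r - d)^d.  Conversely [zvol_scale] bounds N(r) / r^d, for each
    fixed s, by a quantity that tends to a(s) as r grows.  V is positive because
    the ball of radius q d contains q^d points. *)
Lemma zvol_cvg (R : realType) (d : nat) : (0 < d)%N ->
  exists V : R, 0 < V /\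
    (zvol d r)%:R / r%:R ^+ d @[r --> \oo] --> V.
Proof.
move=> d0.
pose a (s : nat) : R := (zvol d (s.+1 + d))%:R / s.+1%:R ^+ d.
pose S : set R := range a.
have S0 : S !=set0 by exists (a 0%N); exists 0%N.
have dd0 : (0 : R) < d%:R ^+ d by rewrite exprn_gt0 // ltr0n.
have lb : lbound S ((d%:R ^+ d)^-1).
  move=> _ [s _ <-]; rewrite /a ler_pdivlMr ?exprn_gt0 ?ltr0n //.
  rewrite mulrC ler_pdivrMr // -!natrX -natrM ler_nat.
  apply: (@leq_trans (((s.+1 %/ d).+1 * d) ^ d)).
    by rewrite leq_exp2r // ltnW // ltn_ceil.
  rewrite expnMn leq_mul2r; apply/orP; right.
  apply: leq_trans (zvol_ge d _) _; apply: leq_zvol.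
  by rewrite mulSn addnC leq_add2r leq_trunc_div.
have Slb : has_lbound S by exists (d%:R ^+ d)^-1.
pose V := inf S; exists V.
have V0 : 0 < V.
  by apply: lt_le_trans (lb_le_inf S0 lb); rewrite invr_gt0.
split=> //.
have lower : \forall r \near \oo, V * (1 + - d%:R / r%:R) ^+ d <=
    (zvol d r)%:R / r%:R ^+ d.
  exists d.+1 => // r /= dr.
  have r0 : (0 : R) < r%:R by rewrite ltr0n (leq_trans _ dr).
  rewrite ler_pdivlMr ?exprn_gt0 // -mulrA -exprMn.
  have -> : (1 + - d%:R / r%:R) * r%:R = (r - d)%N%:R :> R.
    by rewrite natrB 1?ltnW // mulrDl divfK ?gt_eqF // mul1r.
  have rd0 : (0 < r - d)%N by rewrite subn_gt0.
  rewrite -ler_pdivlMr ?exprn_gt0 ?ltr0n //.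
  apply: ge_inf => //; exists (r - d).-1 => //.
  by rewrite /a prednK // subnK // ltnW.
apply/cvgrPdist_lt => e e0.
have e20 : 0 < e / 2 by rewrite divr_gt0.
have [_ [s _ <-] as_lt] := inf_adherent e20 (conj S0 Slb).
rewrite -/V in as_lt.
have as0 : 0 < a s.
  by apply: lt_le_trans V0 _; apply: ge_inf => //; exists s.
have upper : \forall r \near \oo, (zvol d r)%:R / r%:R ^+ d <=
    a s * (1 + s.+1%:R / r%:R) ^+ d.
  exists 1%N => // r /= r1.
  have r0 : (0 : R) < r%:R by rewrite ltr0n.
  rewrite ler_pdivrMr ?exprn_gt0 // -mulrA -exprMn.
  have -> : (1 + s.+1%:R / r%:R) * r%:R = (r + s.+1)%N%:R :> R.
    by rewrite natrD mulrDl divfK ?gt_eqF // mul1r.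
  rewrite /a mulrAC ler_pdivlMr ?exprn_gt0 ?ltr0n //.
  rewrite -!natrX -!natrM ler_nat.
  apply: leq_trans (leq_mul (zvol_le_multiple r d0 (ltn0Sn s)) (leqnn _)) _.
  rewrite -mulnA leq_mul2l -expnMn leq_exp2r //; apply/orP; right.
  by rewrite mulSn addnC leq_add2r leq_trunc_div.
have lim1 : \forall r \near \oo, V - e < V * (1 + - d%:R / r%:R) ^+ d.
  apply: (cvgr_gt V); last by lra.
  rewrite -[X in _ --> X]mulr1; apply: cvgM; first exact: cvg_cst.
  exact: cvg_expr_1addV.
have lim2 : \forall r \near \oo, a s * (1 + s.+1%:R / r%:R) ^+ d < V + e.
  apply: (cvgr_lt (a s)); last by lra.
  rewrite -[X in _ --> X]mulr1; apply: cvgM; first exact: cvg_cst.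
  exact: cvg_expr_1addV.
near=> r; rewrite distrC ltr_norml; apply/andP; split.
  have h1 : V - e < V * (1 + - d%:R / r%:R) ^+ d by near: r.
  have h2 : V * (1 + - d%:R / r%:R) ^+ d <= (zvol d r)%:R / r%:R ^+ d by near: r.
  by have := lt_le_trans h1 h2; lra.
have h1 : a s * (1 + s.+1%:R / r%:R) ^+ d < V + e by near: r.
have h2 : (zvol d r)%:R / r%:R ^+ d <= a s * (1 + s.+1%:R / r%:R) ^+ d by near: r.
by have := le_lt_trans h2 h1; lra.
Unshelve. all: by end_near.
Qed.

(** * Near-orthogonality of random points of a ball *)

Lemma zball_sum_reindex (d r : nat) (f : 'rV[int]_d -> 'rV[int]_d)
    (F : 'rV[int]_d -> int) :
  involutive f -> (forall x, dot (f x) (f x) = dot x x) ->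
  \sum_(x <- zball d r) F (f x) = \sum_(x <- zball d r) F x.
Proof.
move=> fK fdot; rewrite -(big_map f xpredT F); apply: perm_big.
apply: uniq_perm; rewrite ?(map_inj_uniq (inv_inj fK)) ?fset_uniq //.
move=> x; apply/mapP/idP => [[y yr ->]|xr].
  by move: yr; rewrite !in_zball fdot.
by exists (f x); rewrite ?fK // in_zball fdot -in_zball.
Qed.

Lemma zball_cross_moment (d r : nat) (i j : 'I_d) : i != j ->
  \sum_(x <- zball d r) x 0 i * x 0 j = 0.
Proof.
move=> ij.
pose f (x : 'rV[int]_d) : 'rV[int]_d := \row_k (if k == i then - x 0 k else x 0 k).
have fK : involutive f.
  by move=> x; apply/rowP => k; rewrite !mxE; case: eqP; rewrite ?opprK.
have fdot x : dot (f x) (f x) = dot x x.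
  by apply: eq_bigr => k _; rewrite !mxE; case: eqP; rewrite ?mulrNN.
have := zball_sum_reindex r (fun x => x 0 i * x 0 j) fK fdot.
under eq_bigr do rewrite !mxE eqxx eq_sym (negbTE ij) mulNr.
rewrite sumrN; lra.
Qed.

Lemma zball_square_moment (d r : nat) (i j : 'I_d) :
  \sum_(x <- zball d r) x 0 i * x 0 i = \sum_(x <- zball d r) x 0 j * x 0 j.
Proof.
pose f (x : 'rV[int]_d) : 'rV[int]_d := \row_k x 0 (tperm i j k).
have fK : involutive f.
  by move=> x; apply/rowP => k; rewrite !mxE tpermK.
have fdot x : dot (f x) (f x) = dot x x.
  rewrite /dot (reindex_inj (@perm_inj _ (tperm i j))) /=.
  by apply: eq_bigr => k _; rewrite !mxE tpermK.
have := zball_sum_reindex r (fun x => x 0 i * x 0 i) fK fdot.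
by move=> <-; apply: eq_bigr => x _; rewrite !mxE tpermL.
Qed.

(** The ball is invariant under changes of sign and permutations of the
    coordinates, so the second moment matrix of its points is scalar; its trace
    is at most N(r) r^2. *)
Lemma zball_dot_moment (d r : nat) (y : 'rV[int]_d) :
  d%:Z * (\sum_(x <- zball d r) dot x y ^+ 2) <=
  (zvol d r)%:Z * (r%:Z ^+ 2 * dot y y).
Proof.
pose M (i j : 'I_d) := \sum_(x <- zball d r) x 0 i * x 0 j.
have -> : \sum_(x <- zball d r) dot x y ^+ 2 = \sum_i y 0 i * y 0 i * M i i.
  transitivity (\sum_i \sum_j y 0 i * y 0 j * M i j).
    transitivity (\sum_(x <- zball d r) \sum_i \sum_j
        y 0 i * y 0 j * (x 0 i * x 0 j)).
      apply: eq_bigr => x _; rewrite expr2 /dot big_distrlr /=.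
      by apply: eq_bigr => i _; apply: eq_bigr => j _; ring.
    rewrite exchange_big; apply: eq_bigr => i _ /=.
    rewrite exchange_big; apply: eq_bigr => j _ /=.
    by rewrite mulr_sumr.
  apply: eq_bigr => i _; rewrite (bigD1 i) //= big1 ?addr0 // => j ji.
  by rewrite /M zball_cross_moment ?mulr0 // eq_sym.
have dM i : d%:Z * M i i = \sum_(x <- zball d r) dot x x.
  transitivity (\sum_(k < d) M k k); last first.
    by rewrite /M exchange_big.
  rewrite (eq_bigr (fun=> M i i)) => [|k _]; last exact: zball_square_moment.
  by rewrite sumr_const card_ord -mulr_natl natz.
rewrite mulr_sumr; under eq_bigr => i _ do rewrite mulrCA dM.
rewrite -mulr_suml mulrC -/(dot y y) mulrA ler_wpM2r ?dotxx_ge0 //.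
apply: (@le_trans _ _ (\sum_(x <- zball d r) r%:Z ^+ 2)).
  rewrite big_seq [leRHS]big_seq; apply: ler_sum => x; by rewrite in_zball.
by rewrite big_const_seq count_predT iter_addr_0 -mulr_natl natz.
Qed.

Section NearOrthogonal.
Variables (d r k : nat).
Let B := zball d r.
Let V := {ffun 'I_k.+1 -> B}.

(** Resampling the coordinate i of v by an independent point of the ball is an
    involution of pairs (v, x), which reduces the sum to [zball_dot_moment]. *)
Lemma tuple_dot_moment (i j : 'I_k.+1) : i != j ->
  d%:Z * (\sum_(v : V) dot (val (v i)) (val (v j)) ^+ 2) <=
  #|V|%:Z * r%:Z ^+ 4.
Proof.
move=> ij.
pose upd (u : V * B) : V * B :=
  ([ffun l => if l == i then u.2 else u.1 l], u.1 i).
have updK : involutive upd.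
  move=> [v x]; rewrite /upd /= ffunE eqxx; congr pair.
  by apply/ffunP => l; rewrite !ffunE; case: eqP => // ->.
have B0 : 0 < (zvol d r)%:Z.
  rewrite ltz_nat cardfs_gt0; apply/fset0Pn; exists 0.
  by rewrite in_zball dot0l sqr_ge0.
have cB : #|{: B}| = zvol d r by rewrite -cardfE.
pose F (v : V) := dot (val (v i)) (val (v j)) ^+ 2.
have -> : \sum_(v : V) dot (val (v i)) (val (v j)) ^+ 2 = \sum_v F v by [].
have step : (zvol d r)%:Z * (\sum_v F v) =
    \sum_(v : V) \sum_(x <- B) dot x (val (v j)) ^+ 2.
  transitivity (\sum_(u : V * B) F u.1).
    rewrite -(pair_big xpredT xpredT (fun v (x : B) => F v)) /= mulr_sumr.
    by apply: eq_bigr => v _; rewrite sumr_const cB -mulr_natl natz.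
  rewrite (reindex_inj (inv_inj updK)) /=.
  rewrite -(pair_big xpredT xpredT (fun v (x : B) => F (upd (v, x)).1)) /=.
  apply: eq_bigr => v _; rewrite big_seq_fsetE; apply: eq_bigr => x _.
  by rewrite /F !ffunE eqxx eq_sym (negbTE ij).
rewrite -(ler_pM2l B0) mulrCA step mulr_sumr.
apply: (@le_trans _ _ (\sum_(v : V) (zvol d r)%:Z * r%:Z ^+ 4)).
  apply: ler_sum => v _; apply: le_trans (zball_dot_moment r (val (v j))) _.
  rewrite ler_wpM2l // -[4%N]/(2 + 2)%N exprD ler_wpM2l ?sqr_ge0 //.
  by have := valP (v j); rewrite in_zball.
by rewrite sumr_const -mulr_natl natz mulrCA.
Qed.

(** The cosines of the angles are at most 1/e for vectors of maximal norm, cleared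
    of denominators. *)
Definition near_orthogonal (e : nat) : pred V := fun v =>
  [forall i, forall j, (i != j) ==>
    ((e%:Z * dot (val (v i)) (val (v j))) ^+ 2 <= r%:Z ^+ 4)].

(** Chebyshev's inequality for the sum of the squares of the k (k + 1) scalar
    products of distinct entries. *)
Lemma card_near_orthogonal (e : nat) :
  (0 < e)%N -> (0 < r)%N -> (0 < k)%N -> (2 * (k * k.+1) * e ^ 2 <= d)%N ->
  (#|V| <= 2 * #|near_orthogonal e|)%N.
Proof.
move=> e0 r0 k0 de.
pose bad := [predC near_orthogonal e].
suff : (2 * #|bad| <= #|V|)%N.
  rewrite -(cardC (near_orthogonal e)) -/bad.
  by move: #|bad| #|near_orthogonal e| => b g; lia.
have r4 : 0 < r%:Z ^+ 4 by rewrite exprn_gt0 // ltz_nat.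
pose W (v : V) := \sum_(q : 'I_k.+1 * 'I_k.+1 | q.1 != q.2)
   dot (val (v q.1)) (val (v q.2)) ^+ 2.
have W0 v : 0 <= W v by apply: sumr_ge0 => *; exact: sqr_ge0.
have badW : #|bad|%:Z * r%:Z ^+ 4 <= e%:Z ^+ 2 * (\sum_v W v).
  rewrite mulr_sumr (bigID bad) /= -[leLHS]addr0 lerD //; last first.
    by apply: sumr_ge0 => v _; rewrite mulr_ge0 ?sqr_ge0.
  rewrite -natz mulr_natl -sumr_const; apply: ler_sum => v.
  rewrite !inE => /forallPn[i /forallPn[j]].
  rewrite negb_imply -ltNge => /andP[ij /ltW h]; apply: le_trans h _.
  rewrite exprMn ler_wpM2l ?sqr_ge0 // /W (bigD1 (i, j)) //= lerDl.
  by apply: sumr_ge0 => *; exact: sqr_ge0.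
have cardq : #|[pred q : 'I_k.+1 * 'I_k.+1 | q.1 != q.2]| = (k * k.+1)%N.
  have h := cardC [pred q : 'I_k.+1 * 'I_k.+1 | q.1 == q.2].
  have hd : #|[pred q : 'I_k.+1 * 'I_k.+1 | q.1 == q.2]| = k.+1.
    rewrite -[RHS]card_ord -(card_codom (f := fun i : 'I_k.+1 => (i, i))).
      apply: eq_card => -[a b]; rewrite !inE /=; apply/eqP/codomP => [->|].
        by exists b.
      by move=> [c [-> ->]].
    by move=> a b [].
  rewrite hd card_prod !card_ord in h.
  apply/eqP; rewrite -(eqn_add2l k.+1) -[X in _ == X]/(k.+1 + k * k.+1)%N -mulSn -h.
  by rewrite eqn_add2l; apply/eqP/eq_card => q; rewrite !inE.
have sumW : d%:Z * (\sum_v W v) <= (k * k.+1)%:Z * (#|V|%:Z * r%:Z ^+ 4).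
  rewrite /W exchange_big mulr_sumr /=.
  apply: le_trans (ler_sum _ (fun q hq => tuple_dot_moment hq)) _.
  by rewrite sumr_const cardq -mulr_natl natz.
have : (d * #|bad|)%:Z <= (e ^ 2 * (k * k.+1) * #|V|)%:Z.
  have h1 : d%:Z * (#|bad|%:Z * r%:Z ^+ 4) <= d%:Z * (e%:Z ^+ 2 * (\sum_v W v)).
    by rewrite ler_wpM2l.
  have h2 : e%:Z ^+ 2 * (d%:Z * (\sum_v W v)) <=
      e%:Z ^+ 2 * ((k * k.+1)%:Z * (#|V|%:Z * r%:Z ^+ 4)).
    by rewrite ler_wpM2l ?sqr_ge0.
  rewrite -(ler_pM2r r4); move: h1 h2.
  rewrite !PoszM.
  move: (\sum_v W v) (#|bad|%:Z) (#|V|%:Z) => x y z; lra.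
rewrite lez_nat => h.
have h2 := leq_trans (leq_mul de (leqnn #|bad|)) h.
rewrite -(@leq_pmul2l (e ^ 2 * (k * k.+1))); last by rewrite !muln_gt0 e0 k0.
by apply: leq_trans h2; rewrite mulnA; apply/eq_leq; ring.
Qed.

End NearOrthogonal.

(** * Cubes in a ball *)

Lemma int_le_of_sqr (x y : int) : 0 <= y -> x ^+ 2 <= y ^+ 2 -> `|x| <= y.
Proof.
by move=> y0; rewrite -(real_normK (num_real x)) ler_sqr ?nnegrE.
Qed.

Lemma dot_signed_sum (d r k e : nat) (v : {ffun 'I_k.+1 -> zball d r})
    (c : 'I_k.+1 -> int) :
  near_orthogonal e v -> (forall i, `|c i| = 1) ->
  e%:Z * dot (\sum_i c i *: val (v i)) (\sum_i c i *: val (v i)) <=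
    (k.+1 * (e + k))%:Z * r%:Z ^+ 2.
Proof.
move=> /forallP ov c1.
rewrite dot_suml mulr_sumr.
apply: (@le_trans _ _ (\sum_(i < k.+1) (e + k)%:Z * r%:Z ^+ 2)); last first.
  by rewrite sumr_const card_ord -mulr_natl natz mulrA -PoszM.
apply: ler_sum => i _; rewrite dot_sumr (bigD1 i) //= mulrDr PoszD mulrDl.
have diag : dot (val (v i)) (val (v i)) <= r%:Z ^+ 2.
  by have := valP (v i); rewrite in_zball.
have r2 : 0 <= r%:Z ^+ 2 by exact: sqr_ge0.
rewrite lerD //.
  rewrite ler_wpM2l // dotZl dotZr mulrA.
  by rewrite -expr2 -(real_normK (num_real (c i))) c1 expr1n mul1r.
rewrite mulr_sumr.
apply: (@le_trans _ _ (\sum_(j < k.+1 | j != i) r%:Z ^+ 2)); last first.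
  have := cardC1 i; rewrite card_ord /= => ci.
  by rewrite sumr_const ci -mulr_natl natz.
apply: ler_sum => j ji; rewrite dotZl dotZr.
have := ov i => /forallP/(_ j); rewrite eq_sym ji /=.
rewrite -[4%N]/(2 * 2)%N exprM => /(int_le_of_sqr r2) h.
apply: le_trans (ler_norm _) _.
by rewrite mulrCA normrM c1 mul1r mulrCA normrM c1 mul1r.
Qed.

(** Absorbs the rounding error: the difference of the two sides is the square
    norm of y + e z. *)
Lemma dot_perturb (d e : nat) (y z : 'rV[int]_d) :
  e%:Z * dot (y - z) (y - z) <=
    e.+1%:Z * dot y y + (e * e.+1)%:Z * dot z z.
Proof.
have := dotxx_ge0 (y + e%:Z *: z).
have -> : y - z = y + (-1) *: z by rewrite scaleN1r.
rewrite !dotDl !dotDr !dotZl !dotZr (dotC z y) PoszM.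
rewrite -addn1 PoszD.
move: (dot y y) (dot y z) (dot z z) => a b c; nra.
Qed.

(** From a nearly orthogonal family v_0, ..., v_k in the ball of radius 2 m s, put
    h_i = v_i and let a be v_0 - (h_1 + ... + h_k) halved and rounded down.
    Twice a vertex is then a signed sum of the v_i minus a vector of parities,
    so it has norm at most 2 p s by the hypotheses on e and s.  The family is
    recovered from (a, h) and the 2^d possible parities. *)
Lemma many_cubes (d k e m p s n : nat) :
  (0 < k)%N -> (0 < e)%N -> (0 < m)%N -> (0 < s)%N ->
  (2 * (k * k.+1) * e ^ 2 <= d)%N ->
  (e.+1 * k.+1 * (e + k) * m ^ 2 < e ^ 2 * p ^ 2)%N ->
  (e ^ 2 * e.+1 * d <= 4 * s ^ 2)%N ->
  (2 * (p * s) < n)%N ->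
  exists A : {fset 'rV[int]_d}, [/\ in_box n A, #|` A|%fset = zvol d (p * s) &
    (zvol d (2 * m * s) ^ k.+1 <= 2 * (P_ k A * 2 ^ d))%N].
Proof.
move=> k0 e0 m0 s0 de emp eds psn.
pose r := (2 * m * s)%N; pose rho := (p * s)%N.
have r0 : (0 < r)%N by rewrite !muln_gt0 m0 s0.
pose one : 'rV[int]_d := const_mx rho%:Z.
pose tr (x : 'rV[int]_d) := x + one.
have tr_inj : injective tr by move=> x x' /addIr.
pose A := [fset tr x | x in zball d rho]%fset.
exists A; split.
- move=> _ /imfsetP[x /= xr ->] i; rewrite /tr !mxE.
  have : `|x 0 i| <= rho%:Z.
    apply: int_le_of_sqr => //; move: xr; rewrite in_zball; apply: le_trans.
    rewrite /dot (bigD1 i) //= -expr2 lerDl.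
    by apply: sumr_ge0 => j _; rewrite -expr2 sqr_ge0.
  rewrite ler_norml => /andP[h1 h2].
  have h3 : (2 * rho)%:Z < n%:Z by rewrite ltz_nat.
  rewrite PoszM in h3.
  move: h1 h2 h3; move: (x 0 i) rho%:Z n%:Z => z t u.
  by clear=> h1 h2 h3; apply/andP; split; lra.
- by rewrite card_imfset.
have -> : (zvol d r ^ k.+1 = #|{ffun 'I_k.+1 -> zball d r}|)%N.
  by rewrite card_ffun card_ord -cardfE.
apply: leq_trans (card_near_orthogonal e0 r0 k0 de) _; rewrite leq_mul2l /=.
have -> : (2 ^ d = #|{ffun 'I_d -> 'I_2}|)%N by rewrite card_ffun !card_ord.
pose V := {ffun 'I_k.+1 -> zball d r}.
pose h (v : V) : {ffun 'I_k -> 'rV[int]_d} := [ffun i => val (v (lift ord0 i))].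
pose w (v : V) : 'rV[int]_d := val (v ord0) - \sum_i h v i.
pose a (v : V) : 'rV[int]_d := \row_j divz (w v 0 j) 2.
pose par (v : V) : 'rV[int]_d := \row_j modz (w v 0 j) 2.
pose psi (v : V) : {ffun 'I_d -> 'I_2} := [ffun j => inord (absz (par v 0 j))].
have wE v : w v = 2%:Z *: a v + par v.
  by apply/rowP => j; rewrite !mxE mulrC -divz_eq.
have par0 v j : 0 <= par v 0 j by rewrite mxE modz_ge0.
have par1 v j : par v 0 j <= 1.
  by rewrite mxE -ltzD1 ltz_pmod.
apply: (@leq_card_pred_prod _ _ _ _ _ (fun v => (tr (a v), h v)) psi); last first.
  move=> v v' _ _ [/tr_inj ha hh] /ffunP hpsi.
  have hpar : par v = par v'.
    apply/rowP => j; have := congr1 (@nat_of_ord _) (hpsi j).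
    rewrite !ffunE !inordK.
    - by move=> hj; rewrite -(gez0_abs (par0 v j)) -(gez0_abs (par0 v' j)) hj.
    - by rewrite ltnS -lez_nat gez0_abs.
    - by rewrite ltnS -lez_nat gez0_abs.
  have hw : w v = w v' by rewrite !wE ha hpar.
  have h0 : val (v ord0) = val (v' ord0) by move: hw; rewrite /w hh => /addIr.
  apply/ffunP => i; apply: val_inj.
  case: (unliftP ord0 i) => [j ->|-> //].
  by have /ffunP/(_ j) := hh; rewrite !ffunE.
move=> v ov; rewrite in_fset_set; last exact: finite_cubes.
rewrite inE /cubes /= => ep.
set x := a v + \sum_i h v i *+ ep i.
have -> : tr (a v) + \sum_i h v i *+ ep i = tr x by rewrite /tr addrAC.
rewrite mem_imfset //.
rewrite /= in_zball.
pose c (i : 'I_k.+1) : int := if unlift ord0 i is Some j then (if ep j then 1 else -1) else 1.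
have c1 i : `|c i| = 1.
  by rewrite /c; case: unlift => [j|] //; case: (ep j).
pose y := \sum_i c i *: val (v i).
have xE : 2%:Z *: x = y - par v.
  have -> : y = val (v ord0) + \sum_i (2%:Z *: (h v i *+ ep i) - h v i).
    rewrite /y big_ord_recl /c unlift_none scale1r; congr (_ + _).
    apply: eq_bigr => i _; rewrite liftK ffunE.
    case: (ep i); last by rewrite mulr0n scaler0 sub0r scaleN1r.
    by rewrite scale1r mulr1n (_ : 2%:Z = 1 + 1) // scalerDl scale1r addrK.
  have -> : val (v ord0) = w v + \sum_i h v i by rewrite /w subrK.
  rewrite sumrB wE -scaler_sumr scalerDr.
  by rewrite [_ *: \sum_i _ - _]addrC !addrA addrK [_ + par v + _]addrAC addrK.
have ybnd := dot_signed_sum ov c1; rewrite -/y in ybnd.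
have pbnd : dot (par v) (par v) <= d%:Z.
  apply: (@le_trans _ _ (\sum_(j < d) 1)).
    apply: ler_sum => j _.
    by have := par0 v j; have := par1 v j; move: (par v 0 j) => z; clear; nra.
  by rewrite sumr_const card_ord natz.
have dbnd := dot_perturb e y (par v); rewrite -xE dotZl dotZr in dbnd.
have emp' : e.+1%:Z * k.+1%:Z * (e + k)%:Z * m%:Z ^+ 2 + 1 <= e%:Z ^+ 2 * p%:Z ^+ 2.
  by move: emp; rewrite lezD1 -ltz_nat !PoszM !expr2.
have eds' : e%:Z ^+ 2 * e.+1%:Z * d%:Z <= 4 * s%:Z ^+ 2.
  by move: eds; rewrite -lez_nat !PoszM !expr2.
suff : 4 * e%:Z ^+ 2 * dot x x <= 4 * e%:Z ^+ 2 * rho%:Z ^+ 2.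
  by rewrite ler_pM2l // mulr_gt0 // exprn_gt0 // ltz_nat.
have e0' : 0 < e%:Z by rewrite ltz_nat.
have t1 := ler_wpM2l (ltW e0') dbnd.
have t2 : e.+1%:Z * (e%:Z * dot y y) <= e.+1%:Z * ((k.+1 * (e + k))%:Z * r%:Z ^+ 2).
  by rewrite ler_wpM2l.
have t3 : e%:Z * (e * e.+1)%:Z * dot (par v) (par v) <= e%:Z * (e * e.+1)%:Z * d%:Z.
  by rewrite ler_wpM2l // mulr_ge0 // ltW.
have t4 : 4 * s%:Z ^+ 2 * (e.+1%:Z * k.+1%:Z * (e + k)%:Z * m%:Z ^+ 2 + 1) <=
    4 * s%:Z ^+ 2 * (e%:Z ^+ 2 * p%:Z ^+ 2).
  by rewrite ler_wpM2l // mulr_ge0 // sqr_ge0.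
move: t1 t2 t3 t4 eds'; rewrite /r /rho !PoszM.
move: (dot x x) (dot y y) (dot (par v) (par v)) e%:Z e.+1%:Z k.+1%:Z (e + k)%:Z.
move: m%:Z s%:Z p%:Z d%:Z; clear; move=> *; lra.
Qed.

(** * The lower bound *)

Lemma zvol_gt0 (d r : nat) : (0 < zvol d r)%N.
Proof.
rewrite cardfs_gt0; apply/fset0Pn; exists 0.
by rewrite in_zball dot0l sqr_ge0.
Qed.

Lemma ln_zvol_cvg (R : realType) (d : nat) : (0 < d)%N ->
  exists l : R, forall del : R, 0 < del ->
    \forall r \near \oo, `|ln (zvol d r)%:R - d%:R * ln r%:R - l| < del.
Proof.
move=> d0; have [V [V0 cV]] := zvol_cvg R d0; exists (ln V) => del del0.
have cl : ln ((zvol d r)%:R / r%:R ^+ d : R) @[r --> \oo] --> ln V.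
  exact: (continuous_cvg _ (continuous_ln V0) cV).
have /cvgrPdist_lt/(_ del del0) h := cl.
near=> r.
have r0' : (0 < r)%N by near: r; exists 1%N.
have r0 : (0 : R) < r%:R by rewrite ltr0n.
have -> : ln (zvol d r)%:R - d%:R * ln r%:R = ln ((zvol d r)%:R / r%:R ^+ d : R).
  rewrite ln_div ?posrE ?exprn_gt0 ?ltr0n ?zvol_gt0 //.
  by rewrite lnXn // mulr_natl.
by rewrite distrC; near: r.
Unshelve. all: by end_near.
Qed.

(** p / m is a rational number slightly above sqrt (k + 1), the ratio of the
    norm of a sum of k + 1 orthogonal vectors to their common norm. *)
Lemma rational_above_sqrt (R : realType) (k : nat) (del : R) : 0 < del ->
  exists p m : nat, [/\ (0 < p)%N, (0 < m)%N, (k.+1 * m ^ 2 < p ^ 2)%N &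
    k.+1%:R * ln (p%:R / m%:R) <= k.+1%:R / 2 * ln k.+1%:R + del].
Proof.
move=> del0.
have k0 : (0 : R) < k.+1%:R by rewrite ltr0n.
pose x : R := Num.sqrt k.+1%:R.
have x0 : 0 < x by rewrite sqrtr_gt0.
have xx : x ^+ 2 = k.+1%:R by rewrite sqr_sqrtr ?ltW.
pose y := x * expR (del / k.+1%:R).
have xy : x < y by rewrite ltr_pMr // expR_gt1 divr_gt0.
have [q /[!in_itv] /= /andP[xq qy]] := rat_in_itvoo xy.
have q0 : 0 < q by rewrite -(ltr0q R); exact: lt_trans xq.
have n0 : 0 < numq q by rewrite numq_gt0.
have m0 : 0 < denq q by exact: denq_gt0.
have qE : ratr q = (absz (numq q))%:R / (absz (denq q))%:R :> R.
  rewrite /ratr; congr (_ / _).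
    by rewrite -[in LHS](gez0_abs (ltW n0)) -pmulrn.
  by rewrite -[in LHS](gez0_abs (ltW m0)) -pmulrn.
rewrite qE in xq qy.
exists (absz (numq q)), (absz (denq q)).
have p0' : (0 < absz (numq q))%N by rewrite absz_gt0 gt_eqF.
have m0' : (0 < absz (denq q))%N by rewrite absz_gt0 gt_eqF.
move: xq qy p0' m0'; set p := absz (numq q); set m := absz (denq q).
move=> xq qy p0' m0'; split=> //.
  rewrite -(ltr_nat R) natrM !natrX -xx -exprMn ltr_pXn2r ?nnegrE //.
    by rewrite -ltr_pdivlMr ?ltr0n.
  by rewrite mulr_ge0 // ltW.
have h : ln (p%:R / m%:R) <= ln y.
  rewrite ler_ln ?posrE ?divr_gt0 ?ltr0n //; first exact: ltW.
  exact: lt_trans xy.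
have -> : k.+1%:R / 2 * ln k.+1%:R + del = k.+1%:R * ln y.
  rewrite /y lnM ?posrE ?expR_gt0 // expRK -xx lnXn // xx.
  by rewrite -mulr_natl; field; rewrite gt_eqF.
by rewrite ler_pM2l.
Qed.

Lemma ln_P_le (R : realType) (k n d : nat) (A : {fset 'rV[int]_d}) :
  (2 <= n)%N -> (0 < d)%N -> in_box n A -> (0 < P_ k A)%N -> (0 < #|` A|%fset)%N ->
  ln (P_ k A)%:R <= tkn R k n * ln (#|` A|%fset)%:R.
Proof.
move=> n2 d0 boxA P0 A0; have [[_ adm] _] := tkn_smallest R k n2.
rewrite -ln_powR ler_ln ?posrE ?powR_gt0 ?ltr0n //.
exact: adm.
Qed.

(** The limiting coefficient of 1 / ln n in the bound for k + 1 - t_{k,n}. *)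
Definition lower_rate (R : realType) (k : nat) : R :=
  k.+1%:R / 2 * ln k.+1%:R - k%:R * ln 2.

Lemma lower_rate_gt0 (R : realType) (k : nat) : (2 <= k)%N -> 0 < lower_rate R k.
Proof.
move=> k2; rewrite /lower_rate subr_gt0.
have h : (4 ^ k < k.+1 ^ k.+1)%N.
  case: k k2 => [|[|[|k]]] // _.
  apply: (@leq_trans (4 ^ k.+4)); last by rewrite leq_exp2r.
  by rewrite ltn_exp2l.
have : ln ((4 ^ k)%N%:R : R) < ln ((k.+1 ^ k.+1)%N%:R).
  by rewrite ltr_ln ?posrE ?ltr0n ?expn_gt0 // ltr_nat.
rewrite !natrX !lnXn ?ltr0n //.
have -> : (4 : R) = 2 ^+ 2 by rewrite expr2 -natrM.
rewrite lnXn // -![ln _ *+ _]mulr_natl; lra.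
Qed.

(** The error terms are made a small multiple [del] of the limit in this order:
    the ratio p / m first, then e and the dimension d, which also absorbs the
    factor 2 of [card_near_orthogonal], and last n, large enough for the
    asymptotics of the number of integer points. *)
Lemma tkn_lower_rate (R : realType) (k : nat) (ep : R) :
  (2 <= k)%N -> 0 < ep <= 1 ->
  \forall n \near \oo, (k.+1%:R - tkn R k n) * ln n%:R <= (1 + ep) * lower_rate R k.
Proof.
move=> k2 /andP[ep0 ep1].
have L0 := lower_rate_gt0 R k2; set L := lower_rate R k in L0 *.
have k0 : (0 < k)%N by exact: ltnW.
pose del := ep * L / 8.
have del0 : 0 < del by rewrite divr_gt0 // mulr_gt0.
have [p [m [p0 m0 km lnpm]]] := rational_above_sqrt k del0.
pose K := (k.+1 * m ^ 2)%N.
(* p ^ 2 exceeds K = (k + 1) m ^ 2 by at least 1, and e is large enough for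
   this slack, times e ^ 2, to cover K ((k + 1) e + k). *)
pose e := (K * (2 * k).+1).+1.
have K0 : (0 < K)%N by rewrite muln_gt0 expn_gt0 m0.
have emp : (e.+1 * k.+1 * (e + k) * m ^ 2 < e ^ 2 * p ^ 2)%N.
  apply: (@leq_trans (e ^ 2 * K.+1)); last by rewrite leq_mul2l km orbT.
  have -> : (e.+1 * k.+1 * (e + k) * m ^ 2 =
      K * e ^ 2 + K * (k.+1 * e + k))%N by rewrite /K; ring.
  rewrite mulnS addnC [(K * e ^ 2)%N]mulnC ltn_add2r.
  apply: (@leq_ltn_trans (K * (2 * k).+1 * e)).
    rewrite -mulnA leq_mul2l; apply/orP; right.
    have : (k <= k * e)%N by rewrite leq_pmulr.
    move: (e) => e'; lia.
  by rewrite -[(e ^ 2)%N]/(e * e)%N ltn_pmul2r.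
pose d := (2 * (k * k.+1) * e ^ 2 + k.+1 + (Num.trunc (del^-1 * ln 2)).+1)%N.
have d0 : (0 < d)%N by rewrite /d addnS.
have de : (2 * (k * k.+1) * e ^ 2 <= d)%N by rewrite /d -addnA leq_addr.
have dk : (k.+1%:R : R) <= d%:R by rewrite ler_nat /d addnAC leq_addl.
have dln : ln 2 <= del * d%:R.
  rewrite mulrC -ler_pdivrMr // mulrC.
  apply: le_trans (ltW (truncnS_gt _)) _.
  by rewrite ler_nat /d leq_addl.
have dR0 : (0 : R) < d%:R by rewrite ltr0n.
have [l hl] := ln_zvol_cvg R d0.
have del20 : 0 < del / 2 by rewrite divr_gt0.
have m20 : (0 < 2 * m)%N by rewrite muln_gt0.
have near1 : \forall s \near \oo,
    `|ln (zvol d (p * s))%:R - d%:R * ln (p * s)%N%:R - l| < del / 2.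
  exact: (cvg_mulnl _ p0 _ (hl _ del20)).
have near2 : \forall s \near \oo,
    `|ln (zvol d (2 * m * s))%:R - d%:R * ln (2 * m * s)%N%:R - l| < del / 2.
  exact: (cvg_mulnl _ m20 _ (hl _ del20)).
(* The box has room for a ball of radius p s when 2 p s <= n - 1. *)
pose sn (n : nat) := ((n - 1) %/ (2 * p))%N.
have p20 : (0 < 2 * p)%N by rewrite muln_gt0.
have sn_cvg : sn n @[n --> \oo] --> \oo.
  exact: (cvg_comp _ _ (cvg_subnr 1) (cvg_divnr _ p20)).
have near1' : \forall n \near \oo,
    `|ln (zvol d (p * sn n))%:R - d%:R * ln (p * sn n)%N%:R - l| < del / 2.
  exact: (sn_cvg _ near1).
have near2' : \forall n \near \oo,
    `|ln (zvol d (2 * m * sn n))%:R - d%:R * ln (2 * m * sn n)%N%:R - l| < del / 2.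
  exact: (sn_cvg _ near2).
have near3 : \forall s \near \oo, (e ^ 2 * e.+1 * d + 1 <= s)%N.
  by exists (e ^ 2 * e.+1 * d + 1)%N.
have near3' : \forall n \near \oo, (e ^ 2 * e.+1 * d + 1 <= sn n)%N.
  exact: (sn_cvg _ near3).
pose C : R := d%:R * ln 4 - l + del / 2.
pose X : R := expR (C / (ep / 4 * d%:R)).
near=> n.
have n2 : (2 <= n)%N by near: n; exists 2%N.
have nX : X <= n%:R.
  apply: le_trans (ltW (truncnS_gt _)) _; rewrite ler_nat.
  by near: n; exists (Num.trunc X).+1.
pose s := sn n.
have H1 : `|ln (zvol d (p * s))%:R - d%:R * ln (p * s)%N%:R - l| < del / 2.
  by rewrite /s; near: n.
have H2 : `|ln (zvol d (2 * m * s))%:R - d%:R * ln (2 * m * s)%N%:R - l| < del / 2.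
  by rewrite /s; near: n.
have H3 : (e ^ 2 * e.+1 * d + 1 <= s)%N by rewrite /s; near: n.
have s0 : (0 < s)%N by apply: leq_trans H3; rewrite addn1.
have eds : (e ^ 2 * e.+1 * d <= 4 * s ^ 2)%N.
  apply: (@leq_trans s); first by apply: leq_trans H3; rewrite leq_addr.
  by rewrite -[(s ^ 2)%N]/(s * s)%N mulnA leq_pmull // muln_gt0.
have psn : (2 * (p * s) < n)%N.
  rewrite mulnA mulnC; apply: leq_ltn_trans (leq_trunc_div _ _) _.
  by rewrite subn1 prednK // ltnW.
have n4 : (n <= 4 * (p * s))%N.
  have : (n - 1 < s.+1 * (2 * p))%N by rewrite /s /sn ltn_ceil.
  have : (p <= p * s)%N by rewrite leq_pmulr.
  have -> : (s.+1 * (2 * p) = 2 * (p * s) + 2 * p)%N by ring.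
  move: (p * s)%N => ps; clear; lia.
have [A [boxA cardA PA]] := many_cubes k0 (ltn0Sn _ : (0 < e)%N) m0 s0 de emp eds psn.
move: PA; set N := zvol d (p * s) in cardA H1 *; set N' := zvol d (2 * m * s) in H2 *.
move=> PA.
have N0 : (0 < N)%N by exact: zvol_gt0.
have N0' : (0 < N')%N by exact: zvol_gt0.
have P0 : (0 < P_ k A)%N.
  have : (0 < 2 * (P_ k A * 2 ^ d))%N by apply: leq_trans PA; rewrite expn_gt0 N0'.
  by rewrite !muln_gt0 => /andP[_ /andP[]].
have A0 : (0 < #|` A|%fset)%N by rewrite cardA.
have hP := ln_P_le R n2 d0 boxA P0 A0; rewrite cardA in hP.
have PA' : k.+1%:R * ln N'%:R <= (d%:R + 1) * ln 2 + ln (P_ k A)%:R :> R.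
  have : ln ((N' ^ k.+1)%N%:R : R) <= ln (2 * (P_ k A * 2 ^ d))%N%:R.
    by rewrite ler_ln ?posrE ?ltr0n ?ler_nat // !(muln_gt0, expn_gt0) ?P0 ?N0'.
  rewrite natrX lnXn ?ltr0n // !natrM natrX.
  rewrite !lnM ?posrE ?mulr_gt0 ?exprn_gt0 ?ltr0n // lnXn //.
  rewrite -![ln _ *+ _]mulr_natl; lra.
have ps0 : (0 < p * s)%N by rewrite muln_gt0 p0.
have ms0 : (0 < 2 * m * s)%N by rewrite muln_gt0 m20.
have lnps : ln (p * s)%N%:R - ln (2 * m * s)%N%:R = ln (p%:R / m%:R) - ln 2 :> R.
  rewrite ln_div ?posrE ?ltr0n // !natrM !lnM ?posrE ?mulr_gt0 ?ltr0n //; ring.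
have lnn4 : ln n%:R <= ln 4 + ln (p * s)%N%:R :> R.
  rewrite -lnM ?posrE ?ltr0n // -natrM ler_ln ?posrE ?ltr0n ?ler_nat //.
    exact: ltnW.
  by rewrite muln_gt0.
have lnX : C <= ep / 4 * d%:R * ln n%:R.
  rewrite mulrC -ler_pdivrMr; last by rewrite mulr_gt0 // divr_gt0.
  rewrite -[leLHS]expRK ler_ln ?posrE ?expR_gt0 ?ltr0n //; exact: ltnW.
have lnn0 : 0 < ln n%:R :> R by rewrite ln_gt0 // ltr1n.
set u := k.+1%:R - tkn R k n.
(* The lower bound on ln N is only usable if u >= 0; otherwise there is
   nothing to prove. *)
have [u0|u0] := leP 0 u; last first.
  apply: (@le_trans _ _ 0); first by rewrite mulr_le0_ge0 // ltW.
  by rewrite mulr_ge0 ?(ltW L0) //; lra.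
have uN : u * ln N%:R <= d%:R * (L + 3 * del).
  have b1 : ln N%:R - ln N'%:R <= d%:R * (ln (p%:R / m%:R) - ln 2) + del :> R.
    by rewrite -lnps; move: H1 H2; rewrite !ltr_norml => /andP[_ h1] /andP[h2 _]; lra.
  have kR : (0 : R) <= k.+1%:R by [].
  have b2 := ler_wpM2l kR b1.
  have b3 : d%:R * (k.+1%:R * ln (p%:R / m%:R)) <= d%:R * (k.+1%:R / 2 * ln k.+1%:R + del).
    by rewrite ler_pM2l.
  have b4 : del * k.+1%:R <= del * d%:R by rewrite ler_pM2l.
  have kE : k.+1%:R = k%:R + 1 :> R by rewrite -natr1.
  rewrite /u /L /lower_rate.
  move: hP PA' b2 b3 b4 dln; rewrite kE.
  move: (ln N%:R) (ln N'%:R) (ln (P_ k A)%:R) (ln (p%:R / m%:R)) (ln 2) (tkn R k n).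
  move: (d%:R : R) (k%:R : R) (ln (k%:R + 1)) => a1 a2 a3 a4 a5 a6 a7 a8 a9; lra.
have lnN : (1 - ep / 4) * d%:R * ln n%:R <= ln N%:R.
  move: H1; rewrite ltr_norml => /andP[h1 _].
  have b := ler_wpM2l (ltW dR0) lnn4.
  rewrite /C in lnX; lra.
have step : d%:R * ((1 - ep / 4) * (u * ln n%:R)) <= d%:R * (L + 3 * del).
  apply: le_trans uN; have := ler_wpM2l u0 lnN; apply: le_trans.
  by rewrite le_eqVlt; apply/orP; left; apply/eqP; ring.
rewrite ler_pM2l // in step.
have c0 : 0 < 1 - ep / 4 by lra.
rewrite -(ler_pM2l c0); apply: le_trans step _.
have : 0 <= ep * L * (1 - ep).
  by rewrite (mulr_ge0 (mulr_ge0 (ltW ep0) (ltW L0))) // subr_ge0.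
have : 0 <= ep * L by rewrite mulr_ge0 // ltW.
rewrite /del; lra.
Unshelve. all: by end_near.
Qed.

(** * Conclusion *)

Theorem theorem3 (R : realType) :
  exists c : R, 0 < c /\
    forall k : nat, (2 <= k)%N ->
      exists eps : nat -> R, eps n @[n --> \oo] --> (0 : R) /\
        forall n : nat, (2 <= n)%N ->
          k.+1%:R - (1 + eps n) *
            ((k.+1%:R * log2 (k.+1%:R : R) - 2 * k%:R)
               / (2 * log2 (n%:R : R)))
            <= tkn R k n /\
          tkn R k n <= k.+1%:R - c / log2 (n%:R : R).
Proof.
have [c [c0 upper]] := tkn_upper R.
exists c; split=> // k k2.
have L0 := lower_rate_gt0 R k2.
have ln2 : 0 < ln (2 : R) by rewrite ln_gt0 // ltr1n.
have rateE : k.+1%:R * log2 (k.+1%:R : R) - 2 * k%:R = 2 * lower_rate R k / ln 2.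
  by rewrite /log2 /lower_rate; field; rewrite gt_eqF.
pose defect n : R := (k.+1%:R - tkn R k n) * ln n%:R / lower_rate R k - 1.
exists (fun n => Num.max 0 (defect n)); split.
  apply/cvgrPdist_lt => e e0; pose ep := Num.min 1 (e / 2).
  have ep01 : 0 < ep <= 1 by rewrite lt_min ge_min lexx ltr01 divr_gt0.
  have epe : ep < e.
    by apply: (@le_lt_trans _ _ (e / 2)); [rewrite ge_min lexx orbT | lra].
  near=> n.
  have h : (k.+1%:R - tkn R k n) * ln n%:R <= (1 + ep) * lower_rate R k.
    by near: n; exact: tkn_lower_rate.
  rewrite sub0r normrN ger0_norm ?le_max ?lexx // gt_max e0 /=.
  apply: le_lt_trans epe.
  by rewrite /defect lerBlDl ler_pdivrMr.
move=> n n2; split; last exact: upper.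
have lnn : 0 < ln (n%:R : R) by rewrite ln_gt0 // ltr1n.
have dle : defect n <= Num.max 0 (defect n) by rewrite le_max lexx orbT.
rewrite rateE /log2.
have -> : 2 * lower_rate R k / ln 2 / (2 * (ln n%:R / ln 2)) =
    lower_rate R k / ln n%:R by field; rewrite !gt_eqF.
rewrite lerBlDl -lerBlDr mulrA ler_pdivlMr // -ler_pdivrMr //.
by move: dle; rewrite /defect; lra.
Unshelve. all: by end_near.
Qed.
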